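(* Let $(X,\mathsf d)$ be a proper geodesic metric space and let $\varphi:X\to\mathbb R$ be a Kantorovich potential for the cost $c=\mathsf d^2/2$. (1) For all $t\in(0,1)$ and $x\in\mathrm e_t(G_\varphi)$, $$\ell^+_t(x)=\ell^-_t(x)=\bar\ell^+_t(x)=\bar\ell^-_t(x)=\ell(\gamma)$$ for any $\gamma\in G_\varphi$ with $\gamma_t=x$. In other words, $D(\mathring G_\varphi)=\{(x,t)\in X\times(0,1):x=\gamma_t,\ \gamma\in G_\varphi\}\subset D_\ell\cap D_{\bar\ell}$, and moreover $\ell_t(x)=\bar\ell_t(x)$ there. (2) For all $x\in X$, the map $\mathring G_\varphi(x)\ni t\mapsto\ell_t(x)=\bar\ell_t(x)$ is locally Lipschitz: for all $t,s\in\mathring G_\varphi(x)$, $$\big|\sqrt{t(1-t)}\,\ell_t(x)-\sqrt{s(1-s)}\,\ell_s(x)\big|\le\sqrt{\ell_t(x)\ell_s(x)}\,\big|\sqrt{t(1-s)}-\sqrt{s(1-t)}\big|.$$ (3) For all $(x,t)\in D(\mathring G_\varphi)\subset D_\ell\cap D_{\bar\ell}$ and for both $*=\underline{\mathcal P}_2\bar\varphi_t(x)$ and $*=\overline{\mathcal P}_2\varphi_t(x)$, $$-\frac1t\ell_t^2(x)\le\underline\partial_t\frac{\ell_t^2(x)}2\le\underline{\mathcal P}_2\varphi_t(x)\le*\le\overline{\mathcal P}_2\bar\varphi_t(x)\le\overline\partial_t\frac{\bar\ell_t^2(x)}2\le\frac1{1-t}\ell_t^2(x),$$ where the Peano (partial)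 derivatives are with respect to the $t$ variable. (4) For all $(x,t)\in D(\mathring G_\varphi)\subset D_\ell\cap D_{\bar\ell}$, $$\overline\partial_t\frac{\ell_t^2(x)}2\le\overline\partial_t\frac{\bar\ell_t^2(x)}2+\Big(\frac1{1-t}+\frac1t\Big)\ell_t^2(x)\le\Big(\frac2{1-t}+\frac1t\Big)\ell_t^2(x),$$ $$\underline\partial_t\frac{\bar\ell_t^2(x)}2\ge\underline\partial_t\frac{\ell_t^2(x)}2-\Big(\frac1t+\frac1{1-t}\Big)\ell_t^2(x)\ge-\Big(\frac2t+\frac1{1-t}\Big)\ell_t^2(x).$$ In particular, for every $x\in X$, $$\partial_t\varphi_t(x)=\partial_t\bar\varphi_t(x)=\frac{\ell_t^2(x)}2=\frac{\bar\ell_t^2(x)}2\qquad\forall t\in\mathring G_\varphi(x),$$ with $t\mapsto\frac{\ell_t^2(x)}2$ and $t\mapsto\frac{\bar\ell_t^2(x)}2$ continuous on $D_\ell(x)\cap D_{\bar\ell}(x)$, differentiable a.e. there, and having locally bounded lower and upper derivatives on $\mathring G_\varphi(x)\subset D_\ell(x)\cap D_{\bar\ell}(x)$, as in items (3) and (4) above.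
   Context: A metric space is proper if closed balls are compact. $\mathrm{Geo}(X)=\{\gamma:[0,1]\to X:\mathsf d(\gamma_s,\gamma_t)=|s-t|\,\mathsf d(\gamma_0,\gamma_1)\}$, $\ell(\gamma)=\mathsf d(\gamma_0,\gamma_1)$, $\mathrm e_t(\gamma)=\gamma_t$. The $c$-transform of $\psi:X\to\mathbb R\cup\{\pm\infty\}$ is $\psi^c(x)=\inf_{y}\frac{\mathsf d(x,y)^2}2-\psi(y)$. A Kantorovich potential is a function $\varphi:X\to\mathbb R\cup\{-\infty\}$, not identically $-\infty$, with $\varphi=\psi^c$ for some $\psi$ (equivalently $(\varphi^c)^c=\varphi$); then $\varphi$ and $\varphi^c$ are finite everywhere. Set $\varphi_0=\varphi$ and, for $t\in(0,1]$, $-\varphi_t(x)=\inf_y\frac{\mathsf d(x,y)^2}{2t}-\varphi(y)$ (so $\varphi_1=-\varphi^c$). Set $\bar\varphi_1=-\varphi^c$ and, for $t\in[0,1)$, $\bar\varphi_t(x)=\inf_y\frac{\mathsf d(x,y)^2}{2(1-t)}-\varphi^c(y)$ (so $\bar\varphi_0=\varphi$). $G_\varphi=\{\gamma\in\mathrm{Geo}(X):\varphi(\gamma_0)+\varphi^c(\gamma_1)=\ell(\gamma)^2/2\}$; $\mathring G_\varphi(x)=\{t\in(0,1):\exists\gamma\in G_\varphi,\ \gamma_t=x\}$; $D(\mathring G_\varphi)=\{(x,t)\in X\times(0,1):t\in\mathring G_\varphi(x)\}$. For $f:X\to\mathbb R\cup\{+\infty\}$ and $t>0$, with $Q_tf(x)=\inf_y\frac{\mathsf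 d(x,y)^2}{2t}+f(y)$, set $D_f^+(x,t)=\sup\limsup_n\mathsf d(x,y_n)$ and $D_f^-(x,t)=\inf\liminf_n\mathsf d(x,y_n)$, where sup and inf run over all minimizing sequences $\{y_n\}$ in the definition of $Q_tf(x)$. For $(x,t)\in X\times(0,1)$, $\ell_t^\pm(x)=D^\pm_{-\varphi}(x,t)/t$ and $\bar\ell_t^\pm(x)=D^\pm_{-\varphi^c}(x,1-t)/(1-t)$. For $\tilde\ell\in\{\ell,\bar\ell\}$, $D_{\tilde\ell}=\{(x,t)\in X\times(0,1):\tilde\ell_t^+(x)=\tilde\ell_t^-(x)\}$, on which $\tilde\ell_t(x)$ denotes the common value; $D_{\tilde\ell}(x)=\{t:(x,t)\in D_{\tilde\ell}\}$. Derivatives: for $g:A\to\mathbb R$, $A\subset\mathbb R$, and an accumulation point $t_0\in A$ of $A$, the upper/lower derivatives $\overline\partial_tg(t_0)$, $\underline\partial_tg(t_0)$ are the limsup/liminf of $\frac{g(t)-g(t_0)}{t-t_0}$ as $A\ni t\to t_0$; $g$ is differentiable at $t_0$ if these coincide and are finite. $\overline\partial_t\tilde\ell_t^2(x)/2$, $\underline\partial_t\tilde\ell_t^2(x)/2$ are those of the function $t\mapsto\tilde\ell_t^2(x)/2$ on $A=D_{\tilde\ell}(x)$. For $f$ on an open interval, differentiable at $\tau_0$, with $k(\epsilon)=2(f(\tau_0+\epsilon)-f(\tau_0)-\epsilon f'(\tau_0))$, the upper/lower second Peano derivatives are $\overline{\mathcal P}_2f(\tau_0)=\limsup_{\epsilon\to0}k(\epsilon)/\epsilon^2$,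 $\underline{\mathcal P}_2f(\tau_0)=\liminf_{\epsilon\to0}k(\epsilon)/\epsilon^2$. *)

(* Defs.v *)
From HB Require Import structures.
From mathcomp Require Import all_boot all_order all_algebra.
From mathcomp Require Import all_classical all_reals all_analysis.
Set Implicit Arguments.
Unset Strict Implicit.
Unset Printing Implicit Defensive.
Import Order.TTheory GRing.Theory Num.Theory.
Import numFieldNormedType.Exports.
Local Open Scope classical_set_scope.
Local Open Scope ring_scope.

Section MetricSpaces.
Context {R : realType} {X : metricType R}.

Definition proper_space : Prop :=
  forall (x : X) (r : R), compact [set y | mdist x y <= r].

(* A curve [0, 1] -> X is encoded by any extension R -> X; only its values on
   [0, 1] are ever used. *)
Definition Geo : set (R -> X) :=
  [set g | forall s t, 0 <= s <= 1 -> 0 <= t <= 1 ->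
     mdist (g s) (g t) = `|s - t| * mdist (g 0) (g 1)].

Definition len (g : R -> X) : R := mdist (g 0) (g 1).

Definition ev (t : R) (g : R -> X) : X := g t.

Definition geodesic_space : Prop :=
  forall x y : X, exists g, [/\ Geo g, g 0 = x & g 1 = y].

End MetricSpaces.
Arguments proper_space {R} X.
Arguments geodesic_space {R} X.

Section Potentials.
Context {R : realType} {X : metricType R}.
Implicit Types (psi f : X -> \bar R) (phi : X -> R) (x : X) (t : R).

Definition ctransform psi x : \bar R :=
  ereal_inf (range (fun y => ((mdist x y ^+ 2 / 2)%:E - psi y)%E)).

Definition Kantorovich_potential (phi : X -> \bar R) : Prop :=
  [/\ forall x, phi x != +oo%E,
      exists x, phi x != -oo%E &
      exists psi, phi = ctransform psi].

Definition Qfun f x t (y : X) : \bar R :=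
  ((mdist x y ^+ 2 / (2 * t))%:E + f y)%E.

Definition Q t f x : \bar R := ereal_inf (range (Qfun f x t)).

Definition minimizing_seq f x t (y : nat -> X) : Prop :=
  (Qfun f x t \o y) @ \oo --> Q t f x.

Definition Dplus f x t : \bar R :=
  ereal_sup [set limn_esup (fun n => (mdist x (y n))%:E) |
             y in minimizing_seq f x t].

Definition Dminus f x t : \bar R :=
  ereal_inf [set limn_einf (fun n => (mdist x (y n))%:E) |
             y in minimizing_seq f x t].

Definition cconj phi : X -> \bar R := ctransform (EFin \o phi).

Definition opp_pot phi : X -> \bar R := fun y => (- (phi y)%:E)%E.
Definition opp_conj phi : X -> \bar R := fun y => (- cconj phi y)%E.

Definition phit_e phi t x : \bar R :=
  if t == 0 then (phi x)%:E else (- Q t (opp_pot phi) x)%E.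

Definition phibart_e phi t x : \bar R :=
  if t == 1 then opp_conj phi x else Q (1 - t) (opp_conj phi) x.

(* On a proper space, for a real-valued Kantorovich potential phi and t in
   [0, 1], the two values above are finite, so that nothing is lost by fine. *)
Definition phit phi t x : R := fine (phit_e phi t x).
Definition phibart phi t x : R := fine (phibart_e phi t x).

Definition Gphi phi : set (R -> X) :=
  [set g | Geo g /\
     ((phi (g 0))%:E + cconj phi (g 1%R))%E = (len g ^+ 2 / 2)%:E].

Definition Gint phi x : set R :=
  [set t | 0 < t < 1 /\ exists2 g, Gphi phi g & g t = x].

Definition DG phi : set (X * R) :=
  [set p | 0 < p.2 < 1 /\ Gint phi p.1 p.2].

Definition ellp phi t x : \bar R := (Dplus (opp_pot phi) x t * (t^-1)%:E)%E.
Definition ellm phi t x : \bar R := (Dminus (opp_pot phi) x t * (t^-1)%:E)%E.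
Definition ellbarp phi t x : \bar R :=
  (Dplus (opp_conj phi) x (1 - t) * ((1 - t)^-1)%:E)%E.
Definition ellbarm phi t x : \bar R :=
  (Dminus (opp_conj phi) x (1 - t) * ((1 - t)^-1)%:E)%E.

Definition Dell phi : set (X * R) :=
  [set p | 0 < p.2 < 1 /\ ellp phi p.2 p.1 = ellm phi p.2 p.1].
Definition Dellbar phi : set (X * R) :=
  [set p | 0 < p.2 < 1 /\ ellbarp phi p.2 p.1 = ellbarm phi p.2 p.1].

Definition Dell_at phi x : set R := [set t | Dell phi (x, t)].
Definition Dellbar_at phi x : set R := [set t | Dellbar phi (x, t)].

(* Meaningful on Dell, resp. Dellbar, where it is the common value of the two
   extended reals; that value is finite under the same assumptions as above. *)
Definition ell phi t x : R := fine (ellp phi t x).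
Definition ellbar phi t x : R := fine (ellbarp phi t x).

Definition ellsq phi x (t : R) : R := ell phi t x ^+ 2 / 2.
Definition ellbarsq phi x (t : R) : R := ellbar phi t x ^+ 2 / 2.

End Potentials.

Section Derivatives.
Context {R : realType}.
Implicit Types (A : set R) (g f : R -> R) (t : R).

Definition upper_deriv A g t : \bar R :=
  limf_esup (fun s => ((g s - g t) / (s - t))%:E) (within A t^').
Definition lower_deriv A g t : \bar R :=
  limf_einf (fun s => ((g s - g t) / (s - t))%:E) (within A t^').

(* If t is not an accumulation point of A, the upper derivative is -oo and the
   lower one is +oo, so g is then not differentiable in this sense. *)
Definition differentiable_in A g t : Prop :=
  upper_deriv A g t = lower_deriv A g t /\ upper_deriv A g t \is a fin_num.

Definition peano_rem f t (e : R) : R := 2 * (f (t + e) - f t - e * derive1 f t).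

Definition upper_peano2 f t : \bar R :=
  limf_esup (fun e => (peano_rem f t e / e ^+ 2)%:E) (0 : R)^'.
Definition lower_peano2 f t : \bar R :=
  limf_einf (fun e => (peano_rem f t e / e ^+ 2)%:E) (0 : R)^'.

Definition locally_bounded_on A (h : R -> \bar R) : Prop :=
  forall t, A t -> exists M : R,
    \forall s \near within A (nbhs t), (`|h s| <= M%:E)%E.

End Derivatives.

(* Main.v *)
(* For a fixed point x the function p(t) = - Q_t f(x) is convex in the variable
   1 / t, with subgradients - D^-(x, t)^2 / 2 and - D^+(x, t)^2 / 2.  Hence D^-
   and D^+ are nondecreasing in t, they agree outside a null set (Lebesgue's
   theorem on monotone functions), and p' = l_t^2 / 2 wherever they agree.  This
   applies to f = - phi and, after the reflection t -> 1 - t, to f = - phi^c.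

   Along a geodesic g of G_phi, convexity of the square forces the distance from
   g_t to any minimizing sequence to converge to t * len g, and phi_t <= phibar_t
   with equality at g_t; so the two functions of time touch to first order at t,
   which orders their second Peano derivatives.  Inequality (2) is c-cyclical
   monotonicity for two geodesics through x.  In (3), the outer bounds come from
   the monotonicity of t^2 l_t^2, and the comparison of the lower derivative of
   l_t^2 / 2 with the Peano derivative of phi_t amounts to integrating p'.  In (4),
   p lies below a parabola near t, and the slope of p at t + e is bounded by
   comparing with the parabola at t + 2 e. *)
Require Import Defs.
From HB Require Import structures.
From mathcomp Require Import all_boot all_order all_algebra.
From mathcomp Require Import all_classical all_reals all_analysis.
From mathcomp Require Import ring lra.
Set Implicit Arguments.
Unset Strict Implicit.
Unset Printing Implicit Defensive.
Import Order.TTheory GRing.Theory Num.Theory.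
Import numFieldNormedType.Exports.
Local Open Scope classical_set_scope.
Local Open Scope ring_scope.

(** * Upper and lower limits along a filter *)

(** For a fixed competitor y, the functional defining Q_t f(x) is affine in 1 / t with slope d(x,
    y)^2 / 2; this is where the variable 1 / t comes from. Minimizing sequences are handled through
    approximate minimizers, points whose value exceeds the infimum by at most e: those of one time
    are tested at another time.

    The obstacle in the Peano comparisons is that p' = l_t^2 / 2 is known only on the set of times
    where D^- = D^+. That set has full measure but need not contain any interval. It is dense, so a
    bound known on it spreads to all times by monotonicity of t^2 l_t^2. The subgradient
    inequalities hold at every time, so a maximum argument for p minus a slightly tilted parabola
    does the work of the integral.

    Lebesgue's theorem on monotone functions is obtained from Vitali coverings by intervals with
    rational endpoints, so that the exceptional set is a countable union of null sets. *)

Lemma lee_of_lt_fin {R : realType} (x y : \bar R) :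
  (forall c : R, (c%:E < x)%E -> (c%:E <= y)%E) -> (x <= y)%E.
Proof.
move=> H; rewrite leNgt; apply/negP => yx.
case: x y H yx => [x| |] [y| |] //=; rewrite ?lte_fin.
- by move=> /(_ ((x + y) / 2)); rewrite lte_fin lee_fin => H xy; have := H ltac:(lra); lra.
- by move=> /(_ (x - 1)); rewrite lte_fin => H _; have := H ltac:(lra).
- by move=> /(_ (y + 1)); rewrite ltry lee_fin => H _; have := H isT; lra.
- by move=> /(_ 0); rewrite ltry => H _; have := H isT.
Qed.

Lemma lee_of_gt_fin {R : realType} (x y : \bar R) :
  (forall c : R, (y < c%:E)%E -> (x <= c%:E)%E) -> (x <= y)%E.
Proof.
move=> H; rewrite -leeN2; apply: lee_of_lt_fin => c.
by rewrite lteNr leeNr -!EFinN; exact: H.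
Qed.

Section limf_esup_einf.
Variables (T : choiceType) (X : filteredType T) (R : realType) (F : set_system X).
Implicit Types (f g : X -> \bar R) (c : \bar R).
Local Open Scope ereal_scope.

Lemma limf_esup_le f c : F [set s | f s <= c] -> limf_esup f F <= c.
Proof.
move=> Fc; rewrite limf_esupE; apply: (@le_trans _ _ (ereal_sup (f @` [set s | f s <= c]))).
  by apply: ereal_inf_lbound; exists [set s | f s <= c].
by apply: ge_ereal_sup => _ [s /= sc <-].
Qed.

(** Together with [limf_esup_le] this exchanges bounds on an upper limit for eventual inequalities,
    infinite values included. *)
Lemma limf_esup_lt f c : Filter F -> limf_esup f F < c -> F [set s | f s < c].
Proof.
move=> FF; rewrite limf_esupE => /ereal_inf_lt[_ [V FV <-] Vc].
apply: filterS FV => s Vs /=; apply: le_lt_trans Vc.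
by apply: ereal_sup_ubound; exists s.
Qed.

Lemma limf_einf_ge f c : F [set s | c <= f s] -> c <= limf_einf f F.
Proof.
move=> Fc; rewrite /limf_einf leeNr; apply: limf_esup_le.
by rewrite (_ : mkset _ = [set s | c <= f s])//; apply/seteqP; split => s /=; rewrite leeN2.
Qed.

Lemma limf_einf_gt f c : Filter F -> c < limf_einf f F -> F [set s | c < f s].
Proof.
move=> FF; rewrite /limf_einf lteNr => /limf_esup_lt H.
by apply: filterS H => s /=; rewrite lteN2.
Qed.

Lemma limf_einf_le_esup f : ProperFilter F -> limf_einf f F <= limf_esup f F.
Proof.
move=> FF; apply: lee_of_gt_fin => c /limf_esup_lt H.
apply: lee_of_lt_fin => d /limf_einf_gt H'.
have [s [/= s1 s2]] := filter_ex (filterI H H').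
exact: ltW (lt_trans s2 s1).
Qed.

Lemma limf_esup_ge f c : ProperFilter F -> F [set s | c <= f s] -> c <= limf_esup f F.
Proof. by move=> FF /limf_einf_ge /le_trans; apply; exact: limf_einf_le_esup. Qed.

Lemma limf_einf_le f c : ProperFilter F -> F [set s | f s <= c] -> limf_einf f F <= c.
Proof. by move=> FF /limf_esup_le; apply: le_trans; exact: limf_einf_le_esup. Qed.

Lemma le_limf_esup f g : Filter F -> F [set s | f s <= g s] ->
  limf_esup f F <= limf_esup g F.
Proof.
move=> FF fg; apply: lee_of_gt_fin => c /limf_esup_lt H; apply: limf_esup_le.
by apply: filterS2 fg H => s /= /le_lt_trans fgs /fgs /ltW.
Qed.

Lemma le_limf_einf f g : Filter F -> F [set s | f s <= g s] ->
  limf_einf f F <= limf_einf g F.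
Proof.
move=> FF fg; rewrite /limf_einf leeN2; apply: le_limf_esup.
by apply: filterS fg => s /=; rewrite leeN2.
Qed.

Lemma limf_esup_cvg (h : X -> R) (l : R) : ProperFilter F ->
  (forall e : R, (0 < e)%R -> F [set s | (`|h s - l| <= e)%R]) ->
  limf_esup (EFin \o h) F = l%:E.
Proof.
move=> FF H; apply/eqP; rewrite eq_le; apply/andP; split; apply/lee_addgt0Pr => e e0.
  apply: limf_esup_le; apply: filterS (H e e0) => s /=.
  by rewrite ler_norml lee_fin => /andP[? ?]; lra.
rewrite -leeBlDr//; apply: limf_esup_ge; apply: filterS (H e e0) => s /=.
by rewrite ler_norml -EFinB lee_fin => /andP[? ?]; lra.
Qed.

Lemma limf_einf_cvg (h : X -> R) (l : R) : ProperFilter F ->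
  (forall e : R, (0 < e)%R -> F [set s | (`|h s - l| <= e)%R]) ->
  limf_einf (EFin \o h) F = l%:E.
Proof.
move=> FF H; rewrite /limf_einf.
rewrite (_ : \- (EFin \o h) = EFin \o (fun s => (- h s)%R)).
  rewrite (@limf_esup_cvg _ (- l)%R) ?EFinN ?oppeK// => e e0.
  by apply: filterS (H e e0) => s /=; rewrite -opprD normrN.
by apply/funext => s /=; rewrite EFinN.
Qed.

End limf_esup_einf.

(** * Differentiability of monotone functions *)

(** The enumeration serves twice: as a countable Vitali family of intervals, and as a list of pairs
    of slopes separating lower from upper derivatives. The default [lo n + 1] keeps [lo n < hi n] at
    indices coding a badly ordered pair. *)
Lemma rational_intervals_enum (R : realType) : exists lo hi : nat -> R,
  (forall n, lo n < hi n) /\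
  forall a b a' b', a < b -> b <= a' -> a' < b' ->
    exists n, [/\ a < lo n, lo n < b, a' < hi n & hi n < b'].
Proof.
pose pq n : rat * rat := odflt (0, 1) (unpickle n).
pose lo n : R := ratr (pq n).1.
pose hi n : R := if (pq n).1 < (pq n).2 then ratr (pq n).2 else lo n + 1.
exists lo, hi; split=> [n|a b a' b' ab ba' ab'].
  by rewrite /hi; case: ifPn => [|_]; rewrite /lo ?ltr_rat// ltrDl.
have [p] := rat_in_itvoo ab; have [q] := rat_in_itvoo ab'.
rewrite !in_itv/= => /andP[q1 q2] /andP[p1 p2].
have pq' : p < q by rewrite -(ltr_rat R) (lt_trans p2)// (le_lt_trans ba').
exists (pickle (p, q)); rewrite /lo /hi /pq pickleK /= pq'.
by rewrite q1 q2 p1 p2.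
Qed.

(** * Derivatives as first-order expansions *)

Section is_derive_slope.
Context {R : realType}.
Implicit Types (h : R -> R) (x d : R).

Lemma is_derive_slope h x d :
  (forall e, 0 < e -> \forall y \near x, `|h y - h x - d * (y - x)| <= e * `|y - x|) ->
  is_derive x 1 h d.
Proof.
move=> H.
suff cv : (fun k => k^-1 *: ((h \o shift x) (k *: (1:R)) - h x)) @ 0^' --> d.
  by apply: DeriveDef; [exact: (cvgP _ cv) | exact: cvg_lim cv].
apply/cvgrPdist_le => e e0.
have := H e e0 => /nbhs_ballP[r /= r0 Hr].
exists r => //= k /=; rewrite sub0r normrN => kr k0.
have := Hr (k + x); rewrite /ball/= opprD addrCA subrr addr0 normrN => /(_ kr).
rewrite addrK /= /GRing.scale/= mulr1 => Hk.
rewrite -(ler_pM2r (_ : 0 < `|k|)) ?normr_gt0// -normrM mulrBl.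
by rewrite mulrAC mulVf// mul1r distrC.
Qed.

Lemma slope_is_derive h x d : is_derive x 1 h d ->
  forall e, 0 < e -> \forall y \near x, `|h y - h x - d * (y - x)| <= e * `|y - x|.
Proof.
move=> [dh hd] e e0.
have : (fun k => k^-1 *: ((h \o shift x) (k *: (1:R)) - h x)) @ 0^' --> d.
  by rewrite -hd; exact: dh.
move=> /cvgrPdist_le /(_ _ e0) [r /= r0 Hr].
apply/nbhs_ballP; exists r => //= y; rewrite /ball/= => yr.
have [->|yx] := eqVneq y x; first by rewrite !subrr mulr0 subrr normr0 mulr0.
have k0 : y - x != 0 by rewrite subr_eq0.
have yr' : ball 0 r (y - x) by rewrite /ball/= sub0r normrN distrC.
have := Hr (y - x) yr' k0.
rewrite /GRing.scale/= mulr1 subrK => Hk.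
have -> : h y - h x - d * (y - x) = - ((d - (y - x)^-1 * (h y - h x)) * (y - x)).
  by rewrite mulrBl mulrAC mulVf// mul1r opprB.
by rewrite normrN normrM ler_wpM2r.
Qed.

End is_derive_slope.

(** Bounded slopes without a separating rational gap converge to the infimum [d] of their eventual
    upper bounds, along enumerated intervals around [x]. Arbitrary intervals [p, q] containing [x]
    follow by moving the endpoints: outwards for the upper bound, inwards where possible for the
    lower one. *)
Lemma derivable_of_interval_slopes {R : realType} (lo hi : nat -> R) (h : R -> R) (x N : R) :
  (forall n, lo n < hi n) ->
  (forall a b a' b', a < b -> b <= a' -> a' < b' ->
    exists n, [/\ a < lo n, lo n < b, a' < hi n & hi n < b']) ->
  {homo h : x y / x <= y} ->
  let eventually_le (f g : nat -> R) := exists2 e : R, 0 < e & forall n,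
    lo n < x -> x < hi n -> hi n - lo n < e -> f n <= g n in
  let inc n := h (hi n) - h (lo n) in let len n := hi n - lo n in
  0 <= N -> eventually_le inc (fun n => N * len n) ->
  (forall n, 0 <= lo n -> eventually_le (fun k => lo n * len k) inc \/
                          eventually_le inc (fun k => hi n * len k)) ->
  derivable h x 1.
Proof.
move=> lohi lohi_dense hm ev inc len N0 HN Hosc.
pose V := [set v | ev inc (fun n => v * len n)].
have near_x (e : R) : 0 < e -> exists n, [/\ lo n < x, x < hi n, x - lo n < e & hi n - x < e].
  move=> e0; have [|//||n [n1 n2 n3 n4]] := @lohi_dense (x - e) x x (x + e); try lra.
  by exists n; split => //; lra.
have VN : V N by [].
have V0 v : V v -> 0 <= v.
  move=> [e e0 Hv]; have [|n [n1 n2 n3 n4]] := near_x (e / 2); first by rewrite divr_gt0.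
  have {}Hv : 0 <= v * (hi n - lo n).
    by apply: le_trans (Hv n n1 n2 _); [rewrite subr_ge0 hm// ltW|lra].
  by rewrite pmulr_lge0 ?subr_gt0// in Hv.
have hinfV : has_inf V by split; [exists N | exists 0 => v /V0].
pose d := inf V.
have up (e : R) : 0 < e -> exists2 r : R, 0 < r & forall n, lo n < x -> x < hi n ->
    hi n - lo n < r -> h (hi n) - h (lo n) <= (d + e) * (hi n - lo n).
  move=> e0; have [v [r r0 Hr] vd] := inf_adherent e0 hinfV.
  exists r => // n n1 n2 n3; apply: (le_trans (Hr _ n1 n2 n3)).
  by rewrite ler_wpM2r ?subr_ge0 ?ltW.
have dn (e : R) : 0 < e -> exists2 r : R, 0 < r & forall n, lo n < x -> x < hi n ->
    hi n - lo n < r -> (d - e) * (hi n - lo n) <= h (hi n) - h (lo n).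
  move=> e0; have [de0|de0] := ltP (d - e) 0.
    exists 1 => // n n1 n2 _; apply: (@le_trans _ _ 0).
      by rewrite nmulr_rle0// subr_ge0 ltW.
    by rewrite subr_ge0 hm// ltW.
  (* The enumeration now supplies slopes with d - e < lo n < hi n < d; the second alternative of
     [Hosc] would make [hi n] an eventual upper bound below the infimum. *)
  have [|||n [n1 n2 n3 n4]] := @lohi_dense (d - e) (d - e / 2) (d - e / 2) d; try lra.
  have := Hosc n (ltW (le_lt_trans de0 n1)).
  move=> [[r r0 Hr]|/(inf_lbound hinfV.2)/(lt_le_trans n4)]; last by rewrite ltxx.
  exists r => // k k1 k2 k3; apply: le_trans (Hr k k1 k2 k3).
  by rewrite ler_wpM2r ?subr_ge0 ?ltW.
have [eN eN0 {}HN] := HN.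
(* Continuity at [x], needed below when an endpoint of [p, q] is [x] itself. An interval around [x]
   of length at most 2 c has increment at most (N + 1) 2 c <= e. *)
have cont (e : R) : 0 < e -> exists2 r : R, 0 < r & forall y, `|y - x| < r -> `|h y - h x| <= e.
  move=> e0; pose c := Num.min (eN / 2) (e / (N + 1) / 2).
  have N1 : 0 < N + 1 :> R by rewrite ltr_wpDl.
  have c0 : 0 < c by rewrite lt_min !divr_gt0.
  have c1 : c <= eN / 2 by rewrite ge_min lexx.
  have c2 : c <= e / (N + 1) / 2 by rewrite ge_min lexx orbT.
  have [n [n1 n2 n3 n4]] := near_x c c0.
  exists (Num.min (x - lo n) (hi n - x)); first by rewrite lt_min !subr_gt0 n1.
  move=> y; rewrite lt_min => /andP[]; rewrite !ltr_norml => /andP[y1 y2] /andP[y3 y4].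
  have hl : h (hi n) - h (lo n) <= e.
    have nE : hi n - lo n < eN by lra.
    apply: le_trans (HN n n1 n2 nE) _.
    apply: (@le_trans _ _ ((N + 1) * (2 * c))).
      by rewrite /len; apply: ler_pM => //; [lra|rewrite lerDl|lra].
    by move: c2; rewrite !ler_pdivlMr//; lra.
  have h1 : h (lo n) <= h y by apply: hm; lra.
  have h2 : h y <= h (hi n) by apply: hm; lra.
  have h3 : h (lo n) <= h x by apply: hm; lra.
  have h4 : h x <= h (hi n) by apply: hm; lra.
  by rewrite ler_norml; apply/andP; split; lra.
have d0 : 0 <= d by apply: lb_le_inf; [exists N | move=> v /V0].
have upx (e : R) : 0 < e -> exists2 r : R, 0 < r & forall p q, p <= x -> x <= q ->
    q - p < r -> h q - h p <= (d + e) * (q - p).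
  move=> e0; have [r r0 Hr] := up e e0; exists (r / 2); first lra.
  move=> p q px xq pqr; apply/ler_addgt0Pr => z z0.
  clear up dn near_x cont HN VN V0 hinfV Hosc eN0; clearbody d; clear V ev inc len.
  pose c := Num.min (r / 4) (z / (d + e) / 2).
  have de : 0 < d + e by lra.
  have c0 : 0 < c by rewrite lt_min !divr_gt0.
  have c1 : c <= r / 4 by rewrite ge_min lexx.
  have c2 : c <= z / (d + e) / 2 by rewrite ge_min lexx orbT.
  have [|||n [n1 n2 n3 n4]] := @lohi_dense (p - c) p q (q + c); try lra.
  have /hm h1 : lo n <= p by lra.
  have /hm h2 : q <= hi n by lra.
  have := Hr n ltac:(lra) ltac:(lra) ltac:(lra) => h3.
  have h4 : (d + e) * (hi n - lo n) <= (d + e) * (q - p) + (d + e) * (2 * c).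
    by rewrite -mulrDr ler_pM2l//; lra.
  have h5 : (d + e) * (2 * c) <= z.
    by move: c2; rewrite !ler_pdivlMr//; lra.
  lra.
have dnx (e : R) : 0 < e -> exists2 r : R, 0 < r & forall p q, p <= x -> x <= q ->
    q - p < r -> (d - e) * (q - p) <= h q - h p.
  move=> e0; have [r r0 Hr] := dn e e0; exists (r / 2); first lra.
  move=> p q px xq pqr; clear upx up dn near_x HN VN V0 hinfV Hosc eN0; clearbody d; clear V ev inc len.
  have /hm hpq : p <= q by lra.
  have [de0|de0] := leP (d - e) 0.
    apply: (@le_trans _ _ 0); last by lra.
    by rewrite mulr_le0_ge0//; lra.
  apply/ler_addgt0Pr => z z0.
  (* Each endpoint and each value of [h] is off by at most [c], for a total error of at most (2 (d -
     e) + 2) c <= z. *)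
  pose c := Num.min (r / 4) (z / (2 * (d - e) + 2)).
  have de : 0 < 2 * (d - e) + 2 by lra.
  have c0 : 0 < c by rewrite lt_min !divr_gt0.
  have c1 : c <= r / 4 by rewrite ge_min lexx.
  have c2 : c <= z / (2 * (d - e) + 2) by rewrite ge_min lexx orbT.
  have [rc rc0 Hrc] := cont c c0.
  (* Since [lo n < x] has to be strict, for p = x the left endpoint is taken outside [p, q] and
     [cont] controls the loss. *)
  have [a [b [ab bx Hab]]] : exists a b, [/\ a < b, b <= x &
      forall l, a < l -> l < b -> p - c < l < p + c /\ h p - c <= h l].
    have [pl|px'] := ltP p x.
      exists p, (Num.min x (p + c)); rewrite lt_min pl ltrDl c0 ge_min lexx; split => //.
      move=> l pl1; rewrite lt_min => /andP[l1 l2].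
      by have := hm _ _ (ltW pl1); split; [apply/andP; split; lra|lra].
    have {px px'} -> : p = x by lra.
    exists (x - Num.min c rc), x; split => //.
      by rewrite ltrBlDr ltrDl lt_min c0.
    move=> l; rewrite ltrBlDr -ltrBlDl lt_min => /andP[l1 l2] l3.
    have := Hrc l; rewrite ltr_norml ler_norml => Hl.
    have /andP[h1 h2] := Hl ltac:(apply/andP; split; lra).
    by split; [apply/andP; split; lra|lra].
  have [a' [b' [ab' xa Hab']]] : exists a b, [/\ a < b, x <= a &
      forall l, a < l -> l < b -> q - c < l < q + c /\ h l <= h q + c].
    have [xlq|xq'] := ltP x q.
      exists (Num.max x (q - c)), q; rewrite gt_max xlq ltrBlDr ltrDl c0 le_max lexx; split => //.
      move=> l; rewrite gt_max => /andP[l1 l2] lq.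
      by have := hm _ _ (ltW lq); split; [apply/andP; split; lra|lra].
    have {xq xq'} -> : q = x by lra.
    exists x, (x + Num.min c rc); split => //.
      by rewrite ltrDl lt_min c0.
    move=> l l3; rewrite -ltrBlDl lt_min => /andP[l1 l2].
    have := Hrc l; rewrite ltr_norml ler_norml => Hl.
    have /andP[h1 h2] := Hl ltac:(apply/andP; split; lra).
    by split; [apply/andP; split; lra|lra].
  have [n [n1 n2 n3 n4]] := lohi_dense _ _ _ _ ab (le_trans bx xa) ab'.
  have [/andP[l1 l2] l3] := Hab _ n1 n2.
  have [/andP[l4 l5] l6] := Hab' _ n3 n4.
  have h3 := Hr n ltac:(lra) ltac:(lra) ltac:(lra).
  have h4 : (d - e) * (q - p) <= (d - e) * (hi n - lo n) + (d - e) * (2 * c).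
    by rewrite -mulrDr ler_pM2l//; lra.
  have h5 : (d - e) * (2 * c) + 2 * c <= z.
    by move: c2; rewrite !ler_pdivlMr//; lra.
  lra.
apply: (@ex_derive _ _ _ _ _ _ d); apply: is_derive_slope => e e0.
have [r1 r10 H1] := upx e e0; have [r2 r20 H2] := dnx e e0.
clear upx dnx cont up dn near_x HN VN V0 hinfV Hosc eN0; clearbody d; clear V ev inc len.
apply/nbhs_ballP; exists (Num.min r1 r2); first by rewrite /= lt_min r10.
move=> y; rewrite /ball/= lt_min => /andP[].
have [xy|yx] := leP x y => y1 y2.
  have := H1 x y (lexx _) xy; have := H2 x y (lexx _) xy.
  rewrite distrC ger0_norm ?subr_ge0// in y1 y2.
  move=> /(_ y2) ? /(_ y1) ? /=.
  by rewrite ler_norml [`|y - x|]ger0_norm ?subr_ge0//; apply/andP; split; lra.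
have := H1 y x (ltW yx) (lexx _); have := H2 y x (ltW yx) (lexx _).
rewrite ger0_norm ?subr_ge0 ?(ltW yx)// in y1 y2.
move=> /(_ y2) ? /(_ y1) ? /=.
by rewrite ler_norml [`|y - x|]ltr0_norm ?subr_lt0//; apply/andP; split; lra.
Qed.

(** * Vitali coverings by rational intervals and their images *)

Section monotone_differentiation.
Context {R : realType}.
Notation mu := (@lebesgue_measure R).
Variables (lo hi : nat -> R) (h : R -> R).
Hypothesis lohi : forall n, lo n < hi n.
Hypothesis lohi_dense : forall a b a' b', a < b -> b <= a' -> a' < b' ->
    exists n, [/\ a < lo n, lo n < b, a' < hi n & hi n < b'].
Hypothesis hm : {homo h : x y / x <= y}.

Let B n : set R := `]lo n, hi n[.
Let I n : set R := `]h (lo n), h (hi n)[.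

Let BE n : B n = ball ((lo n + hi n) / 2) ((hi n - lo n) / 2).
Proof.
have e1 : (lo n + hi n) / 2 - (hi n - lo n) / 2 = lo n by lra.
have e2 : (lo n + hi n) / 2 + (hi n - lo n) / 2 = hi n by lra.
by rewrite ball_itv /B e1 e2.
Qed.

Let r2 n : 0 < (hi n - lo n) / 2.
Proof. by rewrite divr_gt0// subr_gt0. Qed.

Let radiusB n : (radius (B n))%:num = (hi n - lo n) / 2.
Proof. by rewrite BE radius_ball_num// ltW// r2. Qed.

(** Vitali's fine covering condition at [x] for the subfamily [D]. *)
Let freq (D : set nat) x := forall e : R, 0 < e ->
  exists n, [/\ D n, B n x & hi n - lo n < e].

Let freq_vitali (A : set R) (D : set nat) :
  A `<=` freq D -> vitali_cover A B D.
Proof.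
move=> AD; split=> [n|x /AD fx e e0]; first by rewrite BE; exact: is_ball_ball.
have [n [Dn Bn ne]] := fx e e0; exists n; split => //.
by rewrite radiusB; have := lohi n; lra.
Qed.

Let muB n : mu (B n) = (hi n - lo n)%:E.
Proof. by rewrite lebesgue_measure_itv/= lte_fin lohi EFinB. Qed.

Let muI n : mu (I n) = (h (hi n) - h (lo n))%:E.
Proof.
rewrite lebesgue_measure_itv/= lte_fin.
have := hm (ltW (lohi n)); rewrite le_eqVlt => /predU1P[->|->]; last by rewrite EFinB.
by rewrite ltxx subrr.
Qed.

Let mB n : measurable (B n). Proof. exact: measurable_itv. Qed.
Let mI n : measurable (I n). Proof. exact: measurable_itv. Qed.

Let disjB n m : B n `&` B m = set0 -> hi n <= lo m \/ hi m <= lo n.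
Proof.
move=> nm; apply: contrapT => /not_orP[/negP + /negP]; rewrite -!ltNge => h1 h2.
have := lohi n; have := lohi m => h3 h4.
pose a := Num.max (lo n) (lo m); pose b := Num.min (hi n) (hi m).
have ab : a < b by rewrite /a /b gt_max !lt_min h1 h2 h3 h4.
have aln : lo n <= a by rewrite le_max lexx.
have alm : lo m <= a by rewrite le_max lexx orbT.
have bln : b <= hi n by rewrite ge_min lexx.
have blm : b <= hi m by rewrite ge_min lexx orbT.
have : (B n `&` B m) ((a + b) / 2).
  by split; rewrite /B/= in_itv/=; apply/andP; split; lra.
by rewrite nm.
Qed.

Let disjI n m : B n `&` B m = set0 -> I n `&` I m = set0.
Proof.
by move=> /disjB[] /hm nm; rewrite -subset0 => x [];
  rewrite /I/= !in_itv/= => /andP[? ?] /andP[? ?]; lra.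
Qed.

(** Vitali's theorem covers almost all of [A] by disjoint closed intervals; passing to the open ones
    loses only endpoints, a countable set. Disjoint intervals have disjoint images because [h] is
    monotone. *)
Let vitali_disjoint (A : set R) (D : set nat) : A `<=` freq D ->
  exists2 D' : set nat, D' `<=` D & [/\ trivIset D' B, trivIset D' I &
    mu (A `\` \bigcup_(k in D') B k) = 0%E].
Proof.
move=> /freq_vitali AD.
have rB i : 0 < (radius (B i))%:num by rewrite radiusB r2.
have [D' [_ D'D tD' muD']] := vitali_theorem rB AD.
have tB : trivIset D' B.
  move/trivIsetP : tD' => tD'; apply/trivIsetP => i j Di Dj ij.
  by apply: subsetI_eq0 (tD' _ _ Di Dj ij); exact: subset_closure.
exists D' => //; split => //.
  move/trivIsetP : tB => tB; apply/trivIsetP => i j Di Dj ij.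
  exact/disjI/tB.
apply/eqP; rewrite eq_le measure_ge0 andbT.
pose C := A `\` \bigcup_(k in D') closure (B k).
apply: (@le_trans _ _ (mu (C `|` (range lo `|` range hi)))).
  apply: le_outer_measure => x [Ax Bx].
  case: (pselect ((range lo `|` range hi) x)) => [|lh]; first by right.
  left; split => // -[k D'k]; rewrite BE closure_ballE closed_ball_itv ?r2//=.
  have -> : (lo k + hi k) / 2 - (hi k - lo k) / 2 = lo k by lra.
  have -> : (lo k + hi k) / 2 + (hi k - lo k) / 2 = hi k by lra.
  rewrite in_itv/= => /andP[kx xk]; apply: Bx; exists k => //.
  rewrite /B/= in_itv/= !lt_neqAle kx xk !andbT; apply/andP; split.
    by apply/eqP => lx; apply: lh; left; exists k.
  by apply/eqP => xh; apply: lh; right; exists k.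
apply: (le_trans (outer_measureU2 _ _ _)).
rewrite [X in (X + _)%E]muD' add0e.
rewrite [leLHS](_ : _ = 0%E)//; apply: countable_lebesgue_measure0.
by rewrite -bigcup2E; apply: bigcup_countable => // -[|[|i]] _ //=;
  exact: sub_countable (card_image_le _ _) _.
Qed.

Let muUB (D : set nat) : trivIset D B ->
  mu (\bigcup_(k in D) B k) = (\sum_(0 <= k <oo | k \in D) (hi k - lo k)%:E)%E.
Proof.
move=> tB; rewrite measure_bigcup//; last by move=> i _; exact: mB.
by apply: eq_eseriesr => i _; exact: muB.
Qed.

Let muUI (D : set nat) : trivIset D I ->
  mu (\bigcup_(k in D) I k) =
    (\sum_(0 <= k <oo | k \in D) (h (hi k) - h (lo k))%:E)%E.
Proof.
move=> tI; rewrite measure_bigcup//; last by move=> i _; exact: mI.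
by apply: eq_eseriesr => i _; exact: muI.
Qed.

(** The disjoint images, each at least [v] times as long as its interval, all fit into [W]. *)
Let stretch (A W : set R) (D : set nat) (v : R) : 0 <= v -> A `<=` freq D ->
  (forall n, D n -> v * (hi n - lo n) <= h (hi n) - h (lo n)) ->
  (forall n, D n -> I n `<=` W) ->
  (v%:E * mu A <= mu W)%E.
Proof.
move=> v0 AD Dv DW.
have [D' D'D [tB tI muD']] := vitali_disjoint AD.
have AB : (mu A <= mu (\bigcup_(k in D') B k))%E.
  apply: (@le_trans _ _ (mu ((A `\` \bigcup_(k in D') B k) `|` \bigcup_(k in D') B k))).
    by apply: le_outer_measure => x Ax; case: (pselect ((\bigcup_(k in D') B k) x));
      [right|left].
  by apply: (le_trans (outer_measureU2 _ _ _)); rewrite [X in (X + _)%E]muD' add0e.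
apply: (le_trans (lee_wpmul2l _ AB)); first by rewrite lee_fin.
apply: (@le_trans _ _ (mu (\bigcup_(k in D') I k))); last first.
  by apply: le_outer_measure => x [k /D'D Dk]; exact: DW.
rewrite muUB// muUI// -nneseriesZl => [|i _]; last by rewrite lee_fin subr_ge0 ltW.
by apply: lee_nneseries => [i _ _|i /set_mem /D'D Di];
  rewrite -EFinM lee_fin ?Dv// mulr_ge0// subr_ge0 ltW.
Qed.

Let shrink (A O : set R) (D : set nat) (u : R) : 0 <= u -> A `<=` freq D ->
  (forall n, D n -> h (hi n) - h (lo n) <= u * (hi n - lo n)) ->
  (forall n, D n -> B n `<=` O) ->
  exists2 D' : set nat, mu (A `\` \bigcup_(k in D') B k) = 0%E &
   (mu (\bigcup_(k in D') I k) <= u%:E * mu O)%E.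
Proof.
move=> u0 AD Du DO.
have [D' D'D [tB tI muD']] := vitali_disjoint AD.
exists D' => //.
apply: (@le_trans _ _ (u%:E * mu (\bigcup_(k in D') B k))%E); last first.
  rewrite lee_wpmul2l ?lee_fin//.
  by apply: le_outer_measure => x [k /D'D Dk]; exact: DO.
rewrite muUB// muUI// -nneseriesZl => [|i _]; last by rewrite lee_fin subr_ge0 ltW.
by apply: lee_nneseries => [i _ _|i /set_mem /D'D Di];
  rewrite -?EFinM lee_fin ?Du// subr_ge0 hm// ltW.
Qed.

(** Only short intervals matter for the fine covering condition, so they may be required to lie in a
    given neighbourhood of [x]. *)
Let freqS (D D' : set nat) (c x d : R) : c < x -> x < d -> 
  (forall n, c < lo n -> hi n < d -> D n -> D' n) -> freq D x -> freq D' x.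
Proof.
move=> cx xd DD' fx e e0.
have [|n [Dn]] := fx (Num.min e (Num.min (x - c) (d - x))).
  by rewrite !lt_min e0 !subr_gt0 cx xd.
rewrite /B/= in_itv/= => /andP[n1 n2]; rewrite !lt_min => /and3P[n3 n4 n5].
by exists n; split => //; [apply: DD' => //; lra | rewrite /B/= in_itv/= n1].
Qed.

(** Flat intervals inside an open set barely larger than [A] have images of total length at most u
    (mu A + e). Steep intervals nested in the chosen flat ones force that length to be at least v mu
    A, and u < v. *)
Let oscillating_null (A : set R) (u v : R) : 0 <= u -> u < v -> (mu A < +oo)%E ->
  A `<=` freq [set n | h (hi n) - h (lo n) <= u * (hi n - lo n)] ->
  A `<=` freq [set n | v * (hi n - lo n) <= h (hi n) - h (lo n)] ->
  mu A = 0%E.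
Proof.
move=> u0 uv Afin Au Av.
have key e : 0 < e -> (v%:E * mu A <= u%:E * (mu A + e%:E))%E.
  move=> e0; have [U [oU AU muU]] := outer_measure_open_le A e0.
  pose D1 := [set n | h (hi n) - h (lo n) <= u * (hi n - lo n) /\ B n `<=` U].
  have AD1 : A `<=` freq D1.
    move=> x Ax; have /nbhs_ballP[r /= r0 xrU] : nbhs x U.
      by apply: open_nbhs_nbhs; split => //; exact: AU.
    have c1 : x - r < x by rewrite ltrBlDr ltrDl.
    have c2 : x < x + r by rewrite ltrDl.
    apply: (freqS c1 c2 _ (Au x Ax)) => n n1 n2 Dn.
    split => // y; rewrite /B/= in_itv/= => /andP[y1 y2]; apply: xrU.
      by rewrite ball_itv/= in_itv/=; apply/andP; split; lra.
  have [D' muD' leD'] := shrink u0 AD1 (fun n => @proj1 _ _) (fun n => @proj2 _ _).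
  (* Dropping a null set, every remaining point lies in a chosen flat interval and hence has steep
     intervals inside it. *)
  pose A' := A `&` \bigcup_(k in D') B k.
  have AA' : (mu A <= mu A')%E.
    apply: (@le_trans _ _ (mu ((A `\` \bigcup_(k in D') B k) `|` A'))).
      apply: le_outer_measure => x Ax.
      by case: (pselect ((\bigcup_(k in D') B k) x)) => ?; [right|left].
    by apply: (le_trans (outer_measureU2 _ _ _)); rewrite [X in (X + _)%E]muD' add0e.
  apply: (le_trans (lee_wpmul2l _ AA')); first by rewrite lee_fin; lra.
  apply: (@le_trans _ _ (u%:E * mu U)%E); last by rewrite lee_wpmul2l ?lee_fin.
  apply: le_trans leD'.
  pose D2 := [set k | v * (hi k - lo k) <= h (hi k) - h (lo k) /\
    exists2 n, D' n & lo n <= lo k /\ hi k <= hi n].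
  apply: (@stretch _ _ D2); first lra.
  - move=> x [Ax [n D'n]]; rewrite /B/= in_itv/= => /andP[xn nx].
    apply: (freqS xn nx _ (Av x Ax)) => k k1 k2 Dk.
    by split => //; exists n => //; rewrite !ltW.
  - by move=> n [].
  - move=> k [_ [n D'n [nk kn]]] x Ix; exists n => //.
    move: Ix; rewrite /I/= !in_itv/= => /andP[x1 x2].
    by have := hm nk; have := hm kn => ? ?; apply/andP; split; lra.
have Af : mu A \is a fin_num by rewrite ge0_fin_numE// measure_ge0.
have m0 : 0 <= fine (mu A) by exact/fine_ge0/measure_ge0.
rewrite -(fineK Af); set m := fine (mu A) in m0 *.
have {}key : forall e, 0 < e -> v * m <= u * (m + e).
  by move=> e /key; rewrite -(fineK Af) -/m -EFinD -!EFinM lee_fin.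
have : (v - u) * m <= 0.
  apply/ler_addgt0Pr => e e0.
  have := key (e / (u + 1)); rewrite divr_gt0// ?ltr_wpDl// => /(_ isT).
  have : u * (e / (u + 1)) <= e.
    by rewrite mulrCA ger_pMr// ler_pdivrMr ?ltr_wpDl// mul1r lerDl.
  by rewrite mulrDr mulrBl; lra.
rewrite pmulr_rle0 ?subr_gt0// => m1.
by congr (_%:E); apply: le_anti; rewrite m1 m0.
Qed.

(** Images of disjoint steep intervals stay in ]h a, h b[, so N mu A <= |h b - h a| for every
    [N]. *)
Let steep_null (A : set R) (a b : R) : A `<=` `]a, b[ -> 
  (forall N : nat, A `<=` freq [set n | N%:R * (hi n - lo n) <= h (hi n) - h (lo n)]) ->
  mu A = 0%E.
Proof.
move=> Aab AN.
have Afin : (mu A < +oo)%E.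
  apply: (@le_lt_trans _ _ (mu `]a, b[)); first exact: le_outer_measure.
  by rewrite lebesgue_measure_itv/=; case: ifPn => _; rewrite ?ltry// -EFinB ltry.
have Af : mu A \is a fin_num by rewrite ge0_fin_numE// measure_ge0.
have key (N : nat) : (N%:R%:E * mu A <= (`|h b - h a|)%:E)%E.
  apply: (@le_trans _ _ (mu `]h a, h b[)); last first.
    rewrite lebesgue_measure_itv/=; case: ifPn => _; last by rewrite lee_fin.
    by rewrite -EFinB lee_fin ler_norm.
  apply: (@stretch _ _ [set n | N%:R * (hi n - lo n) <= h (hi n) - h (lo n) /\ (a < lo n /\ hi n < b)]) => //.
  - move=> x Ax; have := Aab x Ax; rewrite /= in_itv/= => /andP[ax xb].
    by apply: (freqS ax xb _ (AN N x Ax)).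
  - by move=> n [].
  - move=> n [_ [/ltW/hm an /ltW/hm nb]] x; rewrite /I/= !in_itv/= => /andP[? ?].
    by apply/andP; split; lra.
have m0 : 0 <= fine (mu A) by exact/fine_ge0/measure_ge0.
rewrite -(fineK Af); set m := fine (mu A) in m0 *.
congr (_%:E); apply: le_anti; rewrite m0 andbT leNgt; apply/negP => mp.
have := key (Num.bound (`|h b - h a| / m)).
have := archi_boundP (divr_ge0 (normr_ge0 (h b - h a)) m0).
by rewrite ltr_pdivrMr// => h1; rewrite -(fineK Af) -/m -EFinM lee_fin leNgt h1.
Qed.

Let nfreq (D : set nat) x : ~ freq D x -> exists2 e : R, 0 < e &
  forall n, lo n < x -> x < hi n -> hi n - lo n < e -> ~ D n.
Proof.
move=> /existsNP[e /not_implyP[e0 /forallNP H]]; exists e => // n n1 n2 ne Dn.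
by apply: (H n); split => //; rewrite /B/= in_itv/= n1.
Qed.

(** Derivability can fail only if the slopes at [x] are unbounded ([steep]) or cross a rational gap
    infinitely often ([osc]); both kinds of points are null and there are countably many gaps. *)
Let negligible_nonderivable (a b : R) :
  mu.-negligible [set x | a < x < b /\ ~ derivable h x 1].
Proof.
pose steep := [set x | a < x < b /\ forall N : nat,
  freq [set n | N%:R * (hi n - lo n) <= h (hi n) - h (lo n)] x].
pose osc n := [set x | a < x < b /\ [/\ 0 <= lo n,
    freq [set k | h (hi k) - h (lo k) <= lo n * (hi k - lo k)] x &
    freq [set k | hi n * (hi k - lo k) <= h (hi k) - h (lo k)] x]].
have Nsteep : mu.-negligible steep.
  apply/negligible_outer_measure; apply: (@steep_null _ a b) => [x []|N x []//].
  by rewrite /= in_itv.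
have Nosc n : mu.-negligible (osc n).
  apply/negligible_outer_measure.
  have [n0|n0] := leP 0 (lo n); last first.
    rewrite (_ : osc n = set0) ?outer_measure0//.
    by rewrite -subset0 => x [_ []]; rewrite leNgt n0.
  apply: (@oscillating_null _ (lo n) (hi n)) => // [|x [_ []]//|x [_ []]//].
  apply: (@le_lt_trans _ _ (mu `]a, b[)).
    by apply: le_outer_measure => x []; rewrite /= in_itv.
  by rewrite lebesgue_measure_itv/=; case: ifPn => _; rewrite ?ltry// -EFinB ltry.
apply: negligibleS (negligibleU Nsteep (negligible_bigcup Nosc)).
move=> x [axb nd]; apply: contrapT => /not_orP[ns no]; apply: nd.
have [N HN] : exists N : nat,
    ~ freq [set n | N%:R * (hi n - lo n) <= h (hi n) - h (lo n)] x.
  by apply/existsNP => H; apply: ns; split.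
have [r r0 Hr] := nfreq HN.
apply: (derivable_of_interval_slopes lohi lohi_dense hm (ler0n _ N)) => [|n n0].
  exists r => // n n1 n2 n3; apply: ltW; rewrite ltNge; apply/negP.
  exact: Hr n1 n2 n3.
have [/nfreq[e e0 He]|] := pselect (~ freq [set k | h (hi k) - h (lo k) <= lo n * (hi k - lo k)] x).
  left; exists e => // k k1 k2 k3; apply: ltW; rewrite ltNge; apply/negP.
  exact: He k1 k2 k3.
move=> /contrapT f1.
have [/nfreq[e e0 He]|] := pselect (~ freq [set k | hi n * (hi k - lo k) <= h (hi k) - h (lo k)] x).
  right; exists e => // k k1 k2 k3; apply: ltW; rewrite ltNge; apply/negP.
  exact: He k1 k2 k3.
by move=> /contrapT f2; exfalso; apply: no; exists n.
Qed.

Lemma nondecreasing_ae_derivable_enum : {ae mu, forall x, derivable h x 1}.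
Proof.
apply: negligibleS (negligible_bigcup (fun n : nat =>
  negligible_nonderivable (- n%:R) n%:R)).
move=> x ndx; have := archi_boundP (normr_ge0 x).
by rewrite ltr_norml => xn; exists (Num.bound `|x|).
Qed.

End monotone_differentiation.

Lemma nondecreasing_ae_derivable {R : realType} (h : R -> R) :
  {homo h : x y / x <= y} ->
  {ae (@lebesgue_measure R), forall x, derivable h x 1}.
Proof.
have [lo [hi [lohi dense]]] := rational_intervals_enum R.
exact: nondecreasing_ae_derivable_enum.
Qed.

(** * The Hopf-Lax semigroup at a point *)

(* The traces at a fixed point [x] of a Hopf-Lax evolution: [p t = - Q_t f x],
   [A t = D^-(x, t)^2 / 2] and [B t = D^+(x, t)^2 / 2].  In the variable [1 / t]
   the function [p] is convex, and [- B], [- A] are subgradients. *)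
Definition profile {R : realType} (p A B : R -> R) : Prop :=
  [/\ forall t, 0 < t < 1 -> 0 <= A t /\ A t <= B t,
      forall r s, 0 < r -> r < s -> s < 1 ->
        B r * (r^-1 - s^-1) <= p s - p r /\ p s - p r <= A s * (r^-1 - s^-1),
      forall t e, 0 < t < 1 -> 0 < e -> exists s, [/\ t < s, s < 1 & A s < B t + e] &
      forall t e, 0 < t < 1 -> 0 < e -> exists s, [/\ 0 < s, s < t & A t - e < B s]].

(* [f] is extended-valued because [cconj phi] may take the value [-oo]. *)
Section hopf_lax.
Context {R : realType} {X : metricType R}.
Variables (f : X -> \bar R) (x : X).
Hypothesis f_lb : exists y0 (a : R), forall y, ((a - mdist y0 y ^+ 2 / 2)%:E <= f y)%E.
Hypothesis f_ub : exists z, (f z < +oo)%E.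
Implicit Types (t s e : R) (y : X).

Let q t : R := fine (Q t f x).
Let dp t : R := fine (Dplus f x t).
Let dm t : R := fine (Dminus f x t).
Let near_min t e y := (Qfun f x t y <= (q t + e)%:E)%E.

(** The lower bound rests on (c + d)^2 <= c^2 / (1 - t) + d^2 / t; t < 1 matters because [f] may
    decrease like - d^2 / 2. *)
Lemma Q_fin_num t : 0 < t < 1 -> Q t f x \is a fin_num.
Proof.
move=> /andP[t0 t1]; rewrite fin_numElt; apply/andP; split.
  have [y0 [a Ha]] := f_lb.
  pose c := mdist x y0.
  apply: (@lt_le_trans _ _ (a - c ^+ 2 / (2 * (1 - t)))%:E); first exact: ltNyr.
  apply: le_ereal_inf_tmp => _ [y _ <-]; rewrite /Qfun.
  apply: (@le_trans _ _ ((mdist x y ^+ 2 / (2 * t))%:E +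
    (a - mdist y0 y ^+ 2 / 2)%:E)%E); last by rewrite leeD2l.
  rewrite -EFinD lee_fin.
  have tri : mdist y0 y <= c + mdist x y by rewrite /c (metric_sym x) metric_triangle.
  have d0 := mdist_ge0 y0 y; set d := mdist x y in tri *.
  have : mdist y0 y ^+ 2 <= (c + d) ^+ 2 by rewrite ler_sqr ?nnegrE//; lra.
  suff : (c + d) ^+ 2 <= c ^+ 2 / (1 - t) + d ^+ 2 / t.
    rewrite [d ^+ 2 / (2 * t)](_ : _ = d ^+ 2 / t / 2); last by field; lra.
    rewrite [c ^+ 2 / (2 * (1 - t))](_ : _ = c ^+ 2 / (1 - t) / 2); last by field; lra.
    lra.
  rewrite -subr_ge0.
  rewrite (_ : _ - _ = (t * c - (1 - t) * d) ^+ 2 / (t * (1 - t))).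
    by apply: divr_ge0; [exact: sqr_ge0|apply: mulr_ge0; lra].
  by field; lra.
have [z fz] := f_ub.
apply: (@le_lt_trans _ _ (Qfun f x t z)); first by apply: ereal_inf_lbound; exists z.
by rewrite /Qfun lte_add_pinfty// ltry.
Qed.

Let qE t : 0 < t < 1 -> Q t f x = (q t)%:E.
Proof. by move=> t01; rewrite /q fineK// Q_fin_num. Qed.

Let Qfun_ge t y : 0 < t < 1 -> ((q t)%:E <= Qfun f x t y)%E.
Proof. by move=> t01; rewrite -qE//; apply: ereal_inf_lbound; exists y. Qed.

Let near_min_ex t e : 0 < t < 1 -> 0 < e -> exists y, near_min t e y.
Proof.
move=> t01 e0; have [_ [y _ <-] ye] := lb_ereal_inf_adherent e0 (Q_fin_num t01).
by exists y; rewrite /near_min EFinD -qE//; exact: ltW.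
Qed.

(** Affinity in 1 / t for a fixed competitor: the source of the convexity of p and of every
    comparison between two times. *)
Let Qfun_shift t s y : 0 < t -> 0 < s ->
  Qfun f x t y = (Qfun f x s y + (mdist x y ^+ 2 / 2 * (t^-1 - s^-1))%:E)%E.
Proof.
move=> t0 s0; rewrite /Qfun addeAC -EFinD; congr (_%:E + _)%E.
by field; rewrite !gt_eqF.
Qed.

Let near_min_shift s e y t : 0 < s < 1 -> 0 < t < 1 -> near_min s e y ->
  (Qfun f x t y <= (q s + e + mdist x y ^+ 2 / 2 * (t^-1 - s^-1))%:E)%E.
Proof.
move=> /andP[s0 _] /andP[t0 _]; rewrite (Qfun_shift y t0 s0) EFinD => H.
by rewrite leeD2r.
Qed.

Let near_min_le s e y t : 0 < s < 1 -> 0 < t < 1 -> near_min s e y ->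
  q t <= q s + e + mdist x y ^+ 2 / 2 * (t^-1 - s^-1).
Proof.
move=> s01 t01 H; rewrite -lee_fin (le_trans (Qfun_ge y t01))//.
exact: near_min_shift.
Qed.

Let near_minW t e e' y : e <= e' -> near_min t e y -> near_min t e' y.
Proof. by move=> ee' /le_trans; apply; rewrite lee_fin lerD2l. Qed.

Let minimizing_near t (y : nat -> X) : 0 < t < 1 -> minimizing_seq f x t y ->
  forall e, 0 < e -> \forall n \near \oo, near_min t e (y n).
Proof.
move=> t01; rewrite /minimizing_seq qE// => /fine_cvgP[yfin /cvgrPdist_le H] e e0.
have {}H := H e e0; near=> n.
have yn : Qfun f x t (y n) \is a fin_num by near: n.
rewrite /near_min -(fineK yn) lee_fin.
have : `|q t - fine (Qfun f x t (y n))| <= e by near: n.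
by rewrite ler_norml => /andP[]; lra.
Unshelve. all: by end_near. Qed.

Let near_minimizing t (y : nat -> X) : 0 < t < 1 ->
  (forall n, near_min t n.+1%:R^-1 (y n)) -> minimizing_seq f x t y.
Proof.
move=> t01 H; rewrite /minimizing_seq qE//.
apply: (@squeeze_cvge _ _ _ _ (cst (q t)%:E) _ (fun n => (q t + n.+1%:R^-1)%:E)).
- by near=> n; rewrite Qfun_ge//=; exact: H.
- exact: cvg_cst.
- apply: cvg_EFin; first by near=> n.
  rewrite -[X in _ --> X]addr0; apply: cvgD; first exact: cvg_cst.
  exact: cvg_harmonic.
Unshelve. all: by end_near. Qed.

Let minimizing_ex t : 0 < t < 1 -> exists u, minimizing_seq f x t u.
Proof.
move=> t01; have /choice[y Hy] : forall n : nat, exists y, near_min t n.+1%:R^-1 y.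
  by move=> n; apply: near_min_ex.
by exists y; exact: near_minimizing.
Qed.

Let near_min_bound t e s y : 0 < t -> t < s -> s < 1 -> near_min t e y ->
  mdist x y ^+ 2 / 2 * (t^-1 - s^-1) <= q t - q s + e.
Proof.
move=> t0 ts s1 H; have := @near_min_le t e y s _ _ H.
by move=> /(_ ltac:(lra)) /(_ ltac:(lra)); lra.
Qed.

Let q_noninc t s : 0 < t -> t <= s -> s < 1 -> q s <= q t.
Proof.
move=> t0 ts s1; apply/ler_addgt0Pr => e e0.
have t01 : 0 < t < 1 by apply/andP; split; lra.
have s01 : 0 < s < 1 by apply/andP; split; lra.
have [y Hy] := near_min_ex t01 e0.
have := near_min_le t01 s01 Hy.
have : s^-1 <= t^-1 by rewrite lef_pV2// posrE//; lra.
rewrite -subr_le0 => ?; have : 0 <= mdist x y ^+ 2 / 2 by rewrite divr_ge0// sqr_ge0.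
by move=> h /le_trans; apply; rewrite gerDl mulr_ge0_le0.
Qed.

(** A near minimizer at time t competes at the later time [s2], and the drop of q from t to [s2]
    bounds its squared distance. Taking [s2] strictly between [s] and 1 leaves a gap [k] uniform in
    t <= s. *)
Let near_min_dist r s : 0 < r -> s < 1 -> exists2 M, 0 <= M &
  forall t y, r <= t -> t <= s -> near_min t 1 y -> mdist x y <= M.
Proof.
move=> r0 s1; have [sr|rs] := ltP s r.
  by exists 0 => // t y rt ts; exfalso; lra.
pose s2 := (1 + s) / 2; have s20 : 0 < s2 by rewrite /s2; lra.
pose k := s^-1 - s2^-1; have k0 : 0 < k.
  by rewrite /k subr_gt0 ltf_pV2 ?posrE /s2; lra.
exists (`|2 * (q r - q s2 + 1) / k| + 1); first by rewrite addr_ge0.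
move=> t y rt ts Hy.
have := @near_min_bound t 1 s2 y ltac:(lra) ltac:(rewrite /s2; lra) ltac:(rewrite /s2; lra) Hy.
have : q t <= q r by apply: q_noninc; lra.
have : k <= t^-1 - s2^-1 by rewrite lerD2r lef_pV2// posrE; lra.
set d := mdist x y => k1 qt H.
have d2 : 0 <= d ^+ 2 / 2 by rewrite divr_ge0// sqr_ge0.
have H1 : d ^+ 2 / 2 * k <= q r - q s2 + 1.
  by apply: le_trans (ler_wpM2l d2 k1) _; lra.
have H2 : d ^+ 2 <= 2 * (q r - q s2 + 1) / k by rewrite ler_pdivlMr//; lra.
have H3 := le_trans H2 (ler_norm _).
suff : d <= d ^+ 2 + 1 by lra.
by have := sqr_ge0 (d - 1); have := sqr_ge0 d; rewrite !expr2; lra.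
Qed.

Let seq_dist t : 0 < t < 1 -> exists2 M, 0 <= M & forall u, minimizing_seq f x t u ->
  \forall n \near \oo, mdist x (u n) <= M.
Proof.
move=> /[dup] t01 /andP[t0 t1]; have [M M0 HM] := near_min_dist t0 t1.
exists M => // u /(minimizing_near t01) /(_ 1 ltr01).
by apply: filterS => n /HM; apply.
Qed.

Lemma Dplus_fin_num t : 0 < t < 1 -> Dplus f x t \is a fin_num.
Proof.
move=> t01; have [M M0 HM] := seq_dist t01; have [u Hu] := minimizing_ex t01.
rewrite fin_numElt; apply/andP; split; last first.
  apply: (@le_lt_trans _ _ M%:E); last exact: ltry.
  apply: ge_ereal_sup => _ [v /HM vM <-]; apply: limf_esup_le.
  by apply: filterS vM => n /=; rewrite lee_fin.
apply: (@lt_le_trans _ _ 0%E); first exact: ltNyr.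
apply: le_ereal_sup_tmp; exists (limn_esup (fun n => (mdist x (u n))%:E)); first by exists u.
by apply: limf_esup_ge; near=> n; rewrite /= lee_fin mdist_ge0.
Unshelve. all: by end_near. Qed.

Lemma Dminus_fin_num t : 0 < t < 1 -> Dminus f x t \is a fin_num.
Proof.
move=> t01; have [M M0 HM] := seq_dist t01; have [u Hu] := minimizing_ex t01.
rewrite fin_numElt; apply/andP; split.
  apply: (@lt_le_trans _ _ 0%E); first exact: ltNyr.
  apply: le_ereal_inf_tmp => _ [v _ <-]; apply: limf_einf_ge.
  by near=> n; rewrite /= lee_fin mdist_ge0.
apply: (@le_lt_trans _ _ M%:E); last exact: ltry.
apply: ge_ereal_inf; exists (limn_einf (fun n => (mdist x (u n))%:E)); first by exists u.
by apply: limf_einf_le; apply: filterS (HM u Hu) => n /=; rewrite lee_fin.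
Unshelve. all: by end_near. Qed.

Let dpE t : 0 < t < 1 -> Dplus f x t = (dp t)%:E.
Proof. by move=> t01; rewrite /dp fineK// Dplus_fin_num. Qed.

Let dmE t : 0 < t < 1 -> Dminus f x t = (dm t)%:E.
Proof. by move=> t01; rewrite /dm fineK// Dminus_fin_num. Qed.

Lemma Dminus_ge0 t : (0 <= Dminus f x t)%E.
Proof.
apply: le_ereal_inf_tmp => _ [v _ <-]; apply: limf_einf_ge.
by near=> n; rewrite /= lee_fin mdist_ge0.
Unshelve. all: by end_near. Qed.

Let dm_ge0 t : 0 <= dm t.
Proof. exact/fine_ge0/Dminus_ge0. Qed.

Let dm_le_dp t : 0 < t < 1 -> dm t <= dp t.
Proof.
move=> t01; rewrite -lee_fin -dmE// -dpE//; have [u Hu] := minimizing_ex t01.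
apply: (@le_trans _ _ (limn_einf (fun n => (mdist x (u n))%:E))).
  by apply: ereal_inf_lbound; exists u.
apply: (le_trans (limn_einf_sup _)).
by apply: ereal_sup_ubound; exists u.
Qed.

Lemma Dminus_le_Dplus t : 0 < t < 1 -> (Dminus f x t <= Dplus f x t)%E.
Proof. by move=> t01; rewrite dmE// dpE// lee_fin dm_le_dp. Qed.

(** Otherwise violating points at the tolerances 1 / (n + 1) would form a minimizing sequence whose
    upper limit exceeds D^+. *)
Let near_min_dp t e : 0 < t < 1 -> 0 < e -> exists2 d, 0 < d &
  forall y, near_min t d y -> mdist x y <= dp t + e.
Proof.
move=> t01 e0; apply: contrapT => H.
have /choice[u Hu] : forall n : nat, exists y, near_min t n.+1%:R^-1 y /\ dp t + e < mdist x y.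
  move=> n; apply: contrapT => /forallNP Hn; apply: H; exists n.+1%:R^-1 => // y Hy.
  by rewrite leNgt; apply/negP => ye; apply: (Hn y).
have Mu : minimizing_seq f x t u by apply: near_minimizing => // n; exact: (Hu n).1.
suff : ((dp t + e)%:E <= Dplus f x t)%E by rewrite dpE// lee_fin; lra.
apply: (@le_trans _ _ (limn_esup (fun n => (mdist x (u n))%:E))); last first.
  by apply: ereal_sup_ubound; exists u.
by apply: limf_esup_ge; near=> n; rewrite /= lee_fin ltW// (Hu n).2.
Unshelve. all: by end_near. Qed.

Let near_min_dm t e : 0 < t < 1 -> 0 < e -> exists2 d, 0 < d &
  forall y, near_min t d y -> dm t - e <= mdist x y.
Proof.
move=> t01 e0; apply: contrapT => H.
have /choice[u Hu] : forall n : nat, exists y, near_min t n.+1%:R^-1 y /\ mdist x y < dm t - e.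
  move=> n; apply: contrapT => /forallNP Hn; apply: H; exists n.+1%:R^-1 => // y Hy.
  by rewrite leNgt; apply/negP => ye; apply: (Hn y).
have Mu : minimizing_seq f x t u by apply: near_minimizing => // n; exact: (Hu n).1.
suff : (Dminus f x t <= (dm t - e)%:E)%E by rewrite dmE// lee_fin; lra.
apply: (@le_trans _ _ (limn_einf (fun n => (mdist x (u n))%:E))).
  by apply: ereal_inf_lbound; exists u.
by apply: limf_einf_le; near=> n; rewrite /= lee_fin ltW// (Hu n).2.
Unshelve. all: by end_near. Qed.

Let near_min_dp_ex t e d : 0 < t < 1 -> 0 < e -> 0 < d ->
  exists2 y, near_min t d y & dp t - e < mdist x y.
Proof.
move=> t01 e0 d0; have : ((dp t - e)%:E < Dplus f x t)%E by rewrite dpE// lte_fin; lra.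
move=> /ereal_sup_gt[_ [u Mu <-]]; apply: contraPP => H; apply/negP; rewrite -leNgt.
apply: limf_esup_le; apply: filterS (minimizing_near t01 Mu d0) => n Hn /=.
by rewrite lee_fin leNgt; apply/negP => h; apply: H; exists (u n).
Qed.

Let near_min_dm_ex t e d : 0 < t < 1 -> 0 < e -> 0 < d ->
  exists2 y, near_min t d y & mdist x y < dm t + e.
Proof.
move=> t01 e0 d0; have : (Dminus f x t < (dm t + e)%:E)%E by rewrite dmE// lte_fin; lra.
move=> /ereal_inf_lt[_ [u Mu <-]]; apply: contraPP => H; apply/negP; rewrite -leNgt.
apply: limf_einf_ge; apply: filterS (minimizing_near t01 Mu d0) => n Hn /=.
by rewrite lee_fin leNgt; apply/negP => h; apply: H; exists (u n).
Qed.

(** A near minimizer at [r] whose distance is close to D^+ competes at time [s]; both tolerances are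
    then absorbed in [z]. *)
Let subgradient_dp r s : 0 < r -> r < s -> s < 1 ->
  dp r ^+ 2 / 2 * (r^-1 - s^-1) <= q r - q s.
Proof.
move=> r0 rs s1; have r01 : 0 < r < 1 by apply/andP; split; lra.
have s01 : 0 < s < 1 by apply/andP; split; lra.
have k0 : 0 < r^-1 - s^-1 by rewrite subr_gt0 ltf_pV2// posrE; lra.
set k := r^-1 - s^-1 in k0 *.
have dp0 : 0 <= dp r := le_trans (dm_ge0 r) (dm_le_dp r01).
apply/ler_addgt0Pr => z z0.
have c0 : 0 < dp r * k + 1 by rewrite ltr_wpDl// mulr_ge0// ltW.
have e0 : 0 < z / 2 / (dp r * k + 1) by rewrite !divr_gt0.
have [|y Hy yd] := near_min_dp_ex r01 e0 (_ : 0 < z / 2); first by rewrite divr_gt0.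
have := near_min_le r01 s01 Hy; rewrite -(opprB r^-1) -/k.
set d := mdist x y in yd *; set e := z / 2 / _ in e0 yd => H.
have He : e * (dp r * k) <= z / 2.
  rewrite /e mulrAC ler_pdivrMr// ler_pM2l; last by rewrite divr_gt0.
  by rewrite lerDl.
have : dp r ^+ 2 / 2 * k <= d ^+ 2 / 2 * k + e * (dp r * k).
  have dE : d ^+ 2 / 2 * k + e * (dp r * k) - dp r ^+ 2 / 2 * k =
      (d ^+ 2 + 2 * e * dp r - dp r ^+ 2) / 2 * k.
    by clearbody d k e; move: (dp r) => D; field.
  rewrite -subr_ge0 dE mulr_ge0 ?(ltW k0)// divr_ge0//.
  have h1 : 0 <= dp r * (d + e - dp r) by rewrite mulr_ge0//; lra.
  have h2 : 0 <= (d - dp r) ^+ 2 by exact: sqr_ge0.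
  by move: h1 h2; rewrite !expr2; lra.
by rewrite mulrN in H; lra.
Qed.

Let subgradient_dm r s : 0 < r -> r < s -> s < 1 ->
  q r - q s <= dm s ^+ 2 / 2 * (r^-1 - s^-1).
Proof.
move=> r0 rs s1; have r01 : 0 < r < 1 by apply/andP; split; lra.
have s01 : 0 < s < 1 by apply/andP; split; lra.
have k0 : 0 < r^-1 - s^-1 by rewrite subr_gt0 ltf_pV2// posrE; lra.
set k := r^-1 - s^-1 in k0 *.
have dm0 := dm_ge0 s.
apply/ler_addgt0Pr => z z0.
have c0 : 0 < (2 * dm s + 1) * k by rewrite mulr_gt0//; lra.
pose e := Num.min 1 (z / ((2 * dm s + 1) * k)).
have e0 : 0 < e by rewrite lt_min ltr01 divr_gt0.
have e1 : e <= 1 by rewrite ge_min lexx.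
have e2 : e * ((2 * dm s + 1) * k) <= z by rewrite -ler_pdivlMr// ge_min lexx orbT.
have [|y Hy yd] := near_min_dm_ex s01 e0 (_ : 0 < z / 2); first by rewrite divr_gt0.
have := near_min_le s01 r01 Hy; rewrite -/k.
have d0 := mdist_ge0 x y; set d := mdist x y in yd d0 * => H.
have : d ^+ 2 / 2 * k <= dm s ^+ 2 / 2 * k + e * ((2 * dm s + 1) * k) / 2.
  have dE : dm s ^+ 2 / 2 * k + e * ((2 * dm s + 1) * k) / 2 - d ^+ 2 / 2 * k =
      (dm s ^+ 2 + e * (2 * dm s + 1) - d ^+ 2) / 2 * k.
    by clearbody d k e; move: (dm s) => D; field.
  rewrite -subr_ge0 dE mulr_ge0 ?(ltW k0)// divr_ge0//.
  have h1 : d ^+ 2 <= (dm s + e) ^+ 2 by rewrite ler_sqr ?nnegrE//; lra.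
  have h2 : 0 <= e * (1 - e) by rewrite mulr_ge0//; lra.
  by move: h1 h2; rewrite !expr2; lra.
lra.
Qed.

(** Near minimizers at a time [s] slightly after [t] are near minimizers at [t]. Their distances are
    thus at most D^+(x, t) and at least D^-(x, s), up to small errors. *)
Let dm_right t e : 0 < t < 1 -> 0 < e ->
  exists s, [/\ t < s, s < 1 & dm s ^+ 2 / 2 < dp t ^+ 2 / 2 + e].
Proof.
move=> t01; have /andP[t0 t1] := t01; move=> e0.
have dp0 : 0 <= dp t := le_trans (dm_ge0 t) (dm_le_dp t01).
pose e' := Num.min 1 (e / (4 * (dp t + 1))).
have e'0 : 0 < e' by rewrite lt_min ltr01 divr_gt0//; lra.
have e'1 : e' <= 1 by rewrite ge_min lexx.
have e'2 : e' * (4 * (dp t + 1)) <= e.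
  by rewrite -ler_pdivlMr ?ge_min ?lexx ?orbT//; lra.
have [d d0 Hd] := near_min_dp t01 e'0.
have [M M0 HM] := @near_min_dist t ((1 + t) / 2) t0 ltac:(lra).
have M1 : 0 < M ^+ 2 + 1 by rewrite ltr_wpDl// sqr_ge0.
(* Going back from [s] to [t] raises the value by at most M^2 h / (2 t^2), which this [h] makes at
   most d / 2. *)
pose h := Num.min ((1 - t) / 2) (d * t ^+ 2 / (M ^+ 2 + 1)).
have h0 : 0 < h by rewrite lt_min !divr_gt0 ?mulr_gt0 ?exprn_gt0 //; lra.
have h1 : h <= (1 - t) / 2 by rewrite ge_min lexx.
have h2 : h * (M ^+ 2 + 1) <= d * t ^+ 2.
  by rewrite -ler_pdivlMr// ge_min lexx orbT.
pose s := t + h; have s01 : 0 < s < 1 by rewrite /s; apply/andP; split; lra.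
exists s; rewrite ltrDl; split => //; first by case/andP: s01.
have [d' d'0 Hd'] := near_min_dm s01 e'0.
have [|y Hy] := @near_min_ex s (Num.min d' (Num.min 1 (d / 2))) s01.
  by rewrite !lt_min d'0 ltr01 divr_gt0.
have Hy1 : mdist x y <= M.
  by apply: (HM s); [rewrite lerDl ltW|rewrite /s; lra|
    apply: near_minW Hy; rewrite !ge_min lexx !orbT].
have Hy2 : dm s - e' <= mdist x y by apply: Hd'; apply: near_minW Hy; rewrite ge_min lexx.
have Hy3 : near_min s (d / 2) y by apply: near_minW Hy; rewrite !ge_min lexx !orbT.
have Hy4 : mdist x y <= dp t + e'.
  apply: Hd; apply: (le_trans (near_min_shift s01 t01 Hy3)); rewrite lee_fin.
  have q1 : q s <= q t by apply: q_noninc; rewrite /s; lra.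
  have dM : mdist x y ^+ 2 <= M ^+ 2 by rewrite ler_sqr ?nnegrE// mdist_ge0.
  have k1 : t^-1 - s^-1 <= h / t ^+ 2.
    rewrite (_ : t^-1 - s^-1 = h / (t * s)); last first.
      by rewrite /s; field; apply/andP; split; lra.
    rewrite ler_pM2l// lef_pV2 ?posrE ?mulr_gt0 ?exprn_gt0//; last by rewrite /s; lra.
    by rewrite expr2 ler_pM2l// /s; lra.
  have k0 : 0 <= t^-1 - s^-1.
    by rewrite subr_ge0 lef_pV2 ?posrE /s; lra.
  have : mdist x y ^+ 2 * (t^-1 - s^-1) <= M ^+ 2 * (h / t ^+ 2).
    by apply: ler_pM => //; exact: sqr_ge0.
  have : M ^+ 2 * (h / t ^+ 2) <= d.
    by rewrite mulrA ler_pdivrMr ?exprn_gt0//; lra.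
  lra.
have dms := dm_ge0 s.
have : dm s ^+ 2 <= (dp t + 2 * e') ^+ 2 by rewrite ler_sqr ?nnegrE//; lra.
have : 0 <= e' * (1 - e') by rewrite mulr_ge0//; lra.
by rewrite !expr2; lra.
Qed.

(** From [s] forward to [t] the penalty of a fixed point decreases and [subgradient_dm] bounds q s -
    q t; so near minimizers at [s] are near minimizers at [t], with distance at least D^-(x, t) up
    to a small error. *)
Let dp_left t e : 0 < t < 1 -> 0 < e ->
  exists s, [/\ 0 < s, s < t & dm t ^+ 2 / 2 - e < dp s ^+ 2 / 2].
Proof.
move=> t01; have /andP[t0 t1] := t01; move=> e0.
have dm0 := dm_ge0 t.
pose e' := e / (4 * (dm t + 1)).
have e'0 : 0 < e' by rewrite divr_gt0//; lra.
have e'2 : e' * (4 * (dm t + 1)) = e by rewrite divfK// gt_eqF//; lra.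
have [d d0 Hd] := near_min_dm t01 e'0.
have M1 : 0 < 2 * dm t ^+ 2 + 1 by rewrite ltr_wpDl// mulr_ge0// sqr_ge0.
pose h := Num.min (t / 2) (d * t ^+ 2 / (2 * dm t ^+ 2 + 1)).
have h0 : 0 < h by rewrite lt_min !divr_gt0 ?mulr_gt0 ?exprn_gt0 //; lra.
have h1 : h <= t / 2 by rewrite ge_min lexx.
have h2 : h * (2 * dm t ^+ 2 + 1) <= d * t ^+ 2.
  by rewrite -ler_pdivlMr// ge_min lexx orbT.
pose s := t - h; have s01 : 0 < s < 1 by rewrite /s; apply/andP; split; lra.
have s0 : 0 < s by rewrite /s; lra.
have st : s < t by rewrite /s; lra.
exists s; split => //.
have [d' d'0 Hd'] := near_min_dp s01 e'0.
have [|y Hy] := @near_min_ex s (Num.min d' (d / 2)) s01.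
  by rewrite lt_min d'0 divr_gt0.
have Hy2 : mdist x y <= dp s + e' by apply: Hd'; apply: near_minW Hy; rewrite ge_min lexx.
have Hy3 : near_min s (d / 2) y by apply: near_minW Hy; rewrite !ge_min lexx !orbT.
have Hy4 : dm t - e' <= mdist x y.
  apply: Hd; apply: (le_trans (near_min_shift s01 t01 Hy3)); rewrite lee_fin.
  have q1 := subgradient_dm s0 st t1.
  have k0 : t^-1 - s^-1 <= 0 by rewrite subr_le0 lef_pV2 ?posrE //; lra.
  have d2 : 0 <= mdist x y ^+ 2 / 2 by rewrite divr_ge0// sqr_ge0.
  have H1 := mulr_ge0_le0 d2 k0.
  have k1 : s^-1 - t^-1 <= 2 * h / t ^+ 2.
    rewrite (_ : s^-1 - t^-1 = 2 * h / (t * (2 * s))); last first.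
      by rewrite /s; field; apply/andP; split; lra.
    rewrite ler_pM2l ?mulr_gt0// lef_pV2 ?posrE ?mulr_gt0 ?exprn_gt0//.
    by rewrite expr2 ler_pM2l// /s; lra.
  have : dm t ^+ 2 / 2 * (s^-1 - t^-1) <= dm t ^+ 2 / 2 * (2 * h / t ^+ 2).
    by rewrite ler_wpM2l// divr_ge0// sqr_ge0.
  have : dm t ^+ 2 / 2 * (2 * h / t ^+ 2) <= d / 2.
    have -> : dm t ^+ 2 / 2 * (2 * h / t ^+ 2) = (h * dm t ^+ 2) / t ^+ 2.
      by move: (dm t) => D; field; lra.
    by rewrite ler_pdivrMr ?exprn_gt0//; lra.
  lra.
have dps : 0 <= dp s := le_trans (dm_ge0 s) (dm_le_dp s01).
have [dme|dme] := ltP (dm t - 2 * e') 0.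
  have : 0 <= dp s ^+ 2 by exact: sqr_ge0.
  have : dm t * dm t <= dm t * (2 * e') by rewrite ler_wpM2l//; lra.
  by rewrite !expr2; lra.
have : (dm t - 2 * e') ^+ 2 <= dp s ^+ 2 by rewrite ler_sqr ?nnegrE//; lra.
have : 0 <= e' ^+ 2 by exact: sqr_ge0.
by rewrite !expr2; lra.
Qed.

Lemma hopf_lax_profile :
  profile (fun t => - fine (Q t f x)) (fun t => fine (Dminus f x t) ^+ 2 / 2)
          (fun t => fine (Dplus f x t) ^+ 2 / 2).
Proof.
split.
- move=> t t01; split; first by rewrite divr_ge0// sqr_ge0.
  have := dm_le_dp t01; have := dm_ge0 t; rewrite /dp /dm => h1 h2.
  by rewrite ler_pM2r ?invr_gt0// ler_sqr ?nnegrE// (le_trans h1).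
- move=> r s r0 rs s1; have := subgradient_dp r0 rs s1; have := subgradient_dm r0 rs s1.
  by rewrite /q /dp /dm => h1 h2; split; lra.
- exact: dm_right.
- exact: dp_left.
Qed.

(** Quadratic growth forces every near minimizer with tolerance k e^2 to have distance within e of
    [l]. *)
Lemma Dplus_Dminus_quadratic t l k : 0 < t < 1 -> 0 < k ->
  (forall y, (Q t f x + (k * (mdist x y - l) ^+ 2)%:E <= Qfun f x t y)%E) ->
  Dplus f x t = l%:E /\ Dminus f x t = l%:E.
Proof.
move=> t01 k0 H.
have near_l e y : 0 < e -> near_min t (k * e ^+ 2) y -> `|mdist x y - l| <= e.
  move=> e0 /(le_trans (H y)); rewrite qE// -EFinD lee_fin lerD2l ler_pM2l//.
  by move=> h; rewrite -ler_sqr ?nnegrE ?normr_ge0 ?(ltW e0)// real_normK ?num_real.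
have hp : dp t <= l.
  apply/ler_addgt0Pr => e e0.
  have e2 : 0 < e / 2 by rewrite divr_gt0.
  have [|y Hy yd] := @near_min_dp_ex t (e / 2) (k * (e / 2) ^+ 2) t01 e2.
    by rewrite mulr_gt0// exprn_gt0.
  by have := near_l _ _ e2 Hy; rewrite ler_norml => /andP[]; lra.
have hm : l <= dm t.
  apply/ler_addgt0Pr => e e0.
  have e2 : 0 < e / 2 by rewrite divr_gt0.
  have [|y Hy yd] := @near_min_dm_ex t (e / 2) (k * (e / 2) ^+ 2) t01 e2.
    by rewrite mulr_gt0// exprn_gt0.
  by have := near_l _ _ e2 Hy; rewrite ler_norml => /andP[]; lra.
have := dm_le_dp t01 => mp; rewrite dpE// dmE//.
by split; congr (_%:E); lra.
Qed.

Let Dplus_ge0 t : 0 < t < 1 -> (0 <= Dplus f x t)%E.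
Proof. by move=> /Dminus_le_Dplus; apply: le_trans; exact: Dminus_ge0. Qed.

Lemma speed_profile :
  profile (fun t => - fine (Q t f x))
    (fun t => t ^+ 2 * (fine (Dminus f x t * (t^-1)%:E)%E ^+ 2 / 2))
    (fun t => t ^+ 2 * (fine (Dplus f x t * (t^-1)%:E)%E ^+ 2 / 2)).
Proof.
have E t (D : \bar R) : 0 < t < 1 -> D \is a fin_num ->
    t ^+ 2 * (fine (D * (t^-1)%:E)%E ^+ 2 / 2) = fine D ^+ 2 / 2.
  move=> /andP[t0 _] Df; rewrite fineM//= exprMn mulrA mulrCA.
  by rewrite -exprMn divff ?gt_eqF// expr1n mulr1.
have Em t (t01 : 0 < t < 1) := E t _ t01 (Dminus_fin_num t01).
have Ep t (t01 : 0 < t < 1) := E t _ t01 (Dplus_fin_num t01).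
have [P1 P2 P3 P4] := hopf_lax_profile; split.
- by move=> t t01; rewrite Em// Ep//; exact: P1.
- move=> r s r0 rs s1; rewrite Em ?Ep; first exact: P2.
    by rewrite r0 (lt_trans rs).
  by rewrite s1 (lt_trans r0).
- move=> t e t01 e0; have [s [ts s1 h]] := P3 t e t01 e0.
  exists s; split => //; rewrite Em ?Ep//.
  by case/andP: t01 => t0 _; rewrite s1 (lt_trans t0).
- move=> t e t01 e0; have [s [s0 st h]] := P4 t e t01 e0.
  exists s; split => //; rewrite Em ?Ep//.
  by case/andP: t01 => _ t1; rewrite s0 (lt_trans st).
Qed.

(** The speeds are finite and nonnegative, so their halved squares determine them; membership in
    D_ell becomes an equation between reals. *)
Lemma speed_eqP t : 0 < t < 1 ->
  (Dplus f x t * (t^-1)%:E = Dminus f x t * (t^-1)%:E)%E <->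
  fine (Dminus f x t * (t^-1)%:E)%E ^+ 2 / 2 = fine (Dplus f x t * (t^-1)%:E)%E ^+ 2 / 2.
Proof.
move=> t01; split=> [->//|]; have /andP[t0 _] := t01.
move/(mulIf (_ : (2^-1 != 0 :> R))) => /(_ ltac:(by rewrite invr_eq0 pnatr_eq0)).
have V0 : (0 <= (t^-1)%:E)%E by rewrite lee_fin invr_ge0 ltW.
move/eqP; rewrite eqrXn2//; last 2 first.
- by apply: fine_ge0; apply: mule_ge0 => //; exact: Dminus_ge0.
- by apply: fine_ge0; apply: mule_ge0 => //; exact: Dplus_ge0.
move/eqP => E; rewrite -[LHS]fineK ?fin_numM ?Dplus_fin_num//.
by rewrite -[RHS]fineK ?fin_numM ?Dminus_fin_num// E.
Qed.

(* [x] is the point at time [t] of a geodesic of length [l] from [z]; the gap in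
   the convexity of the square penalizes the deviation of [mdist x y] from [t * l]. *)
Lemma Q_intermediate_point t l c z : 0 < t < 1 -> mdist x z = t * l ->
  f z = (c - l ^+ 2 / 2)%:E ->
  (forall y, ((c - (mdist x y + (1 - t) * l) ^+ 2 / 2)%:E <= f y)%E) ->
  [/\ Q t f x = (c - (1 - t) * l ^+ 2 / 2)%:E,
      Dplus f x t = (t * l)%:E & Dminus f x t = (t * l)%:E].
Proof.
(* [k] is the coefficient in d^2 / (2 t) - (d + (1 - t) l)^2 / 2 = k (d - t l)^2 - (1 - t) l^2 /
   2. *)
move=> t01 xz fz fy; have /andP[t0 t1] := t01; pose k := (1 - t) / (2 * t).
have k0 : 0 < k by rewrite divr_gt0 ?mulr_gt0// subr_gt0.
have H y : ((c - (1 - t) * l ^+ 2 / 2 + k * (mdist x y - t * l) ^+ 2)%:E <= Qfun f x t y)%E.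
  rewrite /Qfun; apply: (@le_trans _ _ ((mdist x y ^+ 2 / (2 * t))%:E +
    (c - (mdist x y + (1 - t) * l) ^+ 2 / 2)%:E)%E); last by rewrite leeD2l.
  rewrite -EFinD lee_fin /k le_eqVlt; apply/orP; left; apply/eqP.
  by field; rewrite gt_eqF.
have QE : Q t f x = (c - (1 - t) * l ^+ 2 / 2)%:E.
  apply/eqP; rewrite eq_le; apply/andP; split.
    apply: ge_ereal_inf; exists (Qfun f x t z); first by exists z.
    rewrite /Qfun fz xz -EFinD lee_fin le_eqVlt; apply/orP; left; apply/eqP.
    by field; rewrite gt_eqF.
  apply: le_ereal_inf_tmp => _ [y _ <-]; apply: le_trans (H y).
  by rewrite lee_fin lerDl mulr_ge0 ?sqr_ge0// ltW.
have [|Dp Dm] := @Dplus_Dminus_quadratic t (t * l) k t01 k0; last by split.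
by move=> y; rewrite QE -EFinD; exact: H.
Qed.

End hopf_lax.

(** * The Hopf-Lax semigroup as a function of time *)

(** Clamping the argument to [l n, 1 - l n], nonempty since l n <= 1 / 2, gives functions monotone
    on the whole line that agree with [h] near any given point of ]0, 1[ for large [n]. *)
Lemma nondecreasing_ae_derivable01 {R : realType} (h : R -> R) :
  (forall r s, 0 < r -> r <= s -> s < 1 -> h r <= h s) ->
  {ae (@lebesgue_measure R), forall x, 0 < x < 1 -> derivable h x 1}.
Proof.
move=> hm; pose l (n : nat) : R := n.+2%:R^-1.
pose hn n x := h (Num.max (l n) (Num.min x (1 - l n))).
have l0 n : 0 < l n by rewrite invr_gt0.
have l2 n : l n <= 1 / 2 by rewrite div1r lef_pV2 ?posrE// ler_nat.
have hn_m n : {homo hn n : x y / x <= y}.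
  move=> x y xy; have := l2 n; have := l0 n => *; apply: hm.
  - by rewrite lt_max l0.
  - by rewrite le_max2// le_min2.
  - by rewrite gt_max gt_min; apply/andP; split; [lra|apply/orP; right; lra].
apply: negligibleS (negligible_bigcup (fun n => nondecreasing_ae_derivable (hn_m n))).
move=> x /not_implyP[/andP[x0 x1] ndx].
have m0 : 0 < Num.min x (1 - x) by rewrite lt_min x0 subr_gt0.
pose n := Num.bound (Num.min x (1 - x))^-1.
have ln : l n < Num.min x (1 - x).
  rewrite -[ltRHS]invrK ltf_pV2 ?posrE ?invr_gt0//.
  apply: lt_trans (archi_boundP _) _; first by rewrite invr_ge0 ltW.
  by rewrite ltr_nat.
exists n; first exact: I.
move=> dx; apply: ndx; apply: near_eq_derivable dx.
move: ln; rewrite lt_min => /andP[lx xl].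
have x2 : x < 1 - l n by lra.
near=> y; rewrite /hn.
have y1 : l n < y by near: y; exact: lt_nbhsr.
have y2 : y < 1 - l n by near: y; exact: lt_nbhsl.
by rewrite min_l ?(ltW y2)// max_r// ltW.
Unshelve. all: by end_near. Qed.

(** A maximum point before [b] would be exceeded to its right. This stands in for integrating a
    lower bound on the derivative. *)
Lemma increasing_right_le {R : realType} (h : R -> R) (a b : R) : a <= b ->
  {within `[a, b], continuous h} ->
  (forall u, a <= u -> u < b -> exists v, [/\ u < v, v <= b & h u < h v]) ->
  h a <= h b.
Proof.
move=> ab ch H; have [c] := EVT_max ab ch; rewrite in_itv/= => /andP[ac cb] Hc.
have [cb'|bc] := ltP c b; last first.
  have bcE : b = c by lra.
  by rewrite [in leRHS]bcE; apply: Hc; rewrite in_itv/= lexx ab.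
have [v [cv vb hv]] := H c ac cb'.
have /Hc : v \in `[a, b] by rewrite in_itv/= vb (le_trans ac (ltW cv)).
by rewrite leNgt hv.
Qed.

Lemma decreasing_left_ge {R : realType} (h : R -> R) (a b : R) : a <= b ->
  {within `[a, b], continuous h} ->
  (forall u, a < u -> u <= b -> exists v, [/\ a <= v, v < u & h u < h v]) ->
  h b <= h a.
Proof.
move=> ab ch H; have [c] := EVT_max ab ch; rewrite in_itv/= => /andP[ac cb] Hc.
have [ac'|ca] := ltP a c; last first.
  have acE : a = c by lra.
  by rewrite [in leRHS]acE; apply: Hc; rewrite in_itv/= lexx ab.
have [v [av vc hv]] := H c ac' cb.
have /Hc : v \in `[a, b] by rewrite in_itv/= av (le_trans (ltW vc) cb).
by rewrite leNgt hv.
Qed.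

Lemma within_dnbhsP {R : realType} (S V : set R) (t : R) :
  (within S t^') V <->
  exists2 r : R, 0 < r & forall y, `|y - t| < r -> y != t -> S y -> V y.
Proof.
split=> [/nbhs_ballP[r /= r0 H]|[r r0 H]]; last first.
  apply/nbhs_ballP; exists r => // y; rewrite /ball/= distrC => yt ynt Sy; exact: H.
by exists r => // y yt ynt Sy; apply: H => //; rewrite /ball/= distrC.
Qed.

Lemma dnbhsP {R : realType} (V : set R) (t : R) :
  t^' V <-> exists2 r : R, 0 < r & forall y, `|y - t| < r -> y != t -> V y.
Proof.
split=> [/nbhs_ballP[r /= r0 H]|[r r0 H]]; last first.
  by apply/nbhs_ballP; exists r => // y; rewrite /ball/= distrC => yt ynt; exact: H.
by exists r => // y yt ynt; apply: H => //; rewrite /ball/= distrC.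
Qed.

(** * Monotonicity, continuity and first derivative of a profile *)

Section profile_theory.
Context {R : realType}.
Notation mu := (@lebesgue_measure R).
Variables (p a b : R -> R).
Hypothesis P : profile p (fun t => t ^+ 2 * a t) (fun t => t ^+ 2 * b t).
Implicit Types (r s t u e : R).

Let A t := t ^+ 2 * a t.
Let B t := t ^+ 2 * b t.
Let S := [set t | 0 < t < 1 /\ a t = b t].

Lemma profile_AB t : 0 < t < 1 -> 0 <= A t /\ A t <= B t.
Proof. by have [H _ _ _] := P; exact: H. Qed.

Lemma profile_sub r s : 0 < r -> r < s -> s < 1 ->
  B r * (r^-1 - s^-1) <= p s - p r /\ p s - p r <= A s * (r^-1 - s^-1).
Proof. by have [_ H _ _] := P; exact: H. Qed.

Lemma profile_BA r s : 0 < r -> r < s -> s < 1 -> B r <= A s.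
Proof.
move=> r0 rs s1; have [h1 h2] := profile_sub r0 rs s1.
have : B r * (r^-1 - s^-1) <= A s * (r^-1 - s^-1) by lra.
by rewrite ler_pM2r// subr_gt0 ltf_pV2// posrE; lra.
Qed.

Lemma profile_BB r s : 0 < r -> r <= s -> s < 1 -> B r <= B s.
Proof.
move=> r0; rewrite le_eqVlt => /predU1P[->//|rs] s1.
have s01 : 0 < s < 1 by rewrite (lt_trans r0 rs).
have [_ h2] := profile_AB s01.
exact: le_trans (profile_BA r0 rs s1) h2.
Qed.

Let SAB t : S t -> A t = B t.
Proof. by rewrite /A /B => -[_ ->]. Qed.

Let bE t : 0 < t < 1 -> b t = B t / t ^+ 2.
Proof. by move=> /andP[t0 _]; rewrite /B mulrAC divff ?mul1r// expf_neq0// gt_eqF. Qed.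

(** Monotonicity reduces continuity to one good time on each side of [t]. The last two clauses of
    [profile] supply them, and A t = B t closes the gap between their bounds. *)
Lemma profile_continuous_B t : S t -> B @ t --> B t.
Proof.
move=> St; have [t01 _] := St; apply/cvgrPdist_le => e e0.
have [_ _ H1 H2] := P.
have [s1 [ts1 s11 As1]] := H1 t e t01 e0.
have [s0 [s00 s0t Bs0]] := H2 t e t01 e0.
rewrite -/(A s1) -/(B t) in As1; rewrite -/(A t) -/(B s0) (SAB St) in Bs0.
near=> s.
have ss0 : s0 < s by near: s; exact: lt_nbhsr.
have ss1 : s < s1 by near: s; exact: lt_nbhsl.
have h1 : B s <= A s1 by apply: profile_BA; lra.
have h2 : B s0 <= B s by apply: profile_BB; lra.
by rewrite ler_norml; apply/andP; split; lra.
Unshelve. all: by end_near. Qed.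

Lemma profile_continuous_b t : S t -> b @ t --> b t.
Proof.
move=> St; have [/andP[t0 t1] _] := St.
rewrite bE; last by rewrite t0.
have cB : (fun s => B s / s ^+ 2) @ t --> B t / t ^+ 2.
  apply: cvgM; first exact: profile_continuous_B.
  by apply: cvgV; [rewrite expf_neq0// gt_eqF|exact: exprn_continuous].
apply: cvg_trans cB; apply: near_eq_cvg; near=> s; rewrite [RHS]bE//; apply/andP; split.
  by near: s; exact: lt_nbhsr.
by near: s; exact: lt_nbhsl.
Unshelve. all: by end_near. Qed.

(** The subgradient bounds squeeze the difference quotient between B t / (t s) and B s / (t s),
    which both tend to [b t]. *)
Lemma profile_is_derive t : S t -> is_derive t 1 p (b t).
Proof.
move=> St; have [/andP[t0 t1] _] := St; have t01 : 0 < t < 1 by rewrite t0.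
apply: is_derive_slope => e e0.
have cB : (fun s => B s / (t * s)) @ t --> b t.
  rewrite bE// expr2; apply: cvgM; first exact: profile_continuous_B.
  apply: cvgV; first by rewrite mulf_neq0// gt_eqF.
  by apply: cvgM; [exact: cvg_cst|exact: cvg_id].
have cBt : (fun s => B t / (t * s)) @ t --> b t.
  rewrite bE// expr2; apply: cvgM; first exact: cvg_cst.
  apply: cvgV; first by rewrite mulf_neq0// gt_eqF.
  by apply: cvgM; [exact: cvg_cst|exact: cvg_id].
near=> s.
have s0 : 0 < s by near: s; exact: lt_nbhsr.
have s1 : s < 1 by near: s; exact: lt_nbhsl.
have : `|b t - B s / (t * s)| <= e by near: s; move/cvgrPdist_le : cB; apply.
have : `|b t - B t / (t * s)| <= e by near: s; move/cvgrPdist_le : cBt; apply.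
rewrite !ler_norml => /andP[h1 h2] /andP[h3 h4].
have kE r u : 0 < r -> 0 < u -> r^-1 - u^-1 = (u - r) / (r * u).
  by move=> r0 u0; field; rewrite !gt_eqF.
have [ts|st|<-] := ltgtP t s; last by rewrite !subrr normr0 !mulr0 subrr oppr0 lexx.
- have [g1 g2] := profile_sub t0 ts s1.
  have As : A s <= B s by apply: (profile_AB _).2; rewrite s0.
  rewrite ger0_norm ?subr_ge0 ?(ltW ts)//.
  have k0 : 0 < s - t by rewrite subr_gt0.
  have ts0 : 0 <= (t * s)^-1 by rewrite invr_ge0 ltW// mulr_gt0.
  rewrite !kE// !mulrA in g1 g2.
  have g3 : A s * (s - t) / (t * s) <= B s / (t * s) * (s - t).
    by rewrite mulrAC; apply: ler_wpM2r; [exact: ltW|exact: ler_wpM2r].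
  have g4 : B t * (s - t) / (t * s) = B t / (t * s) * (s - t) by rewrite mulrAC.
  have g5 := ler_wpM2r (ltW k0) h2.
  have g6 := ler_wpM2r (ltW k0) h3.
  by apply/andP; split; lra.
- have [g1 g2] := profile_sub s0 st t1.
  rewrite (SAB St) in g2.
  rewrite ltr0_norm ?subr_lt0//.
  have k0 : 0 < t - s by rewrite subr_gt0.
  rewrite !kE// (mulrC s) !mulrA in g1 g2.
  have g3 : B s * (t - s) / (t * s) = B s / (t * s) * (t - s) by rewrite mulrAC.
  have g4 : B t * (t - s) / (t * s) = B t / (t * s) * (t - s) by rewrite mulrAC.
  have g5 := ler_wpM2r (ltW k0) h4.
  have g6 := ler_wpM2r (ltW k0) h1.
  by apply/andP; split; lra.
Unshelve. all: by end_near. Qed.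

End profile_theory.

Lemma derivable_differentiable_in {R : realType} (S : set R) (g : R -> R) (t : R) :
  ProperFilter (within S t^') -> derivable g t 1 -> differentiable_in S g t.
Proof.
move=> PS dg.
have Hs e : 0 < e -> (within S t^') [set s | `|(g s - g t) / (s - t) - 'D_1 g t| <= e].
  move=> e0; have /nbhs_ballP[r /= r0 Hr] := slope_is_derive (derivableP dg) e0.
  apply/within_dnbhsP; exists r => // s sr st _ /=.
  have {}st : s - t != 0 by rewrite subr_eq0.
  have := Hr s; rewrite /ball/= distrC => /(_ sr) {}Hr.
  by rewrite -(ler_pM2r (_ : 0 < `|s - t|)) ?normr_gt0// -normrM mulrBl divfK.
have E1 := limf_esup_cvg PS Hs; have E2 := limf_einf_cvg PS Hs.
rewrite /differentiable_in /upper_deriv /lower_deriv.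
by split; [rewrite [LHS]E1 [RHS]E2|rewrite [X in X \is a _]E1].
Qed.

(** * The set of agreement and the lower derivative along it *)

Section profile_derivatives.
Context {R : realType}.
Notation mu := (@lebesgue_measure R).
Variables (p a b : R -> R).
Hypothesis P : profile p (fun t => t ^+ 2 * a t) (fun t => t ^+ 2 * b t).
Implicit Types (r s t u e : R).

Let A t := t ^+ 2 * a t.
Let B t := t ^+ 2 * b t.
Let S := [set t | 0 < t < 1 /\ a t = b t].

Let bE t : 0 < t < 1 -> b t = B t / t ^+ 2.
Proof. by move=> /andP[t0 _]; rewrite /B mulrAC divff ?mul1r// expf_neq0// gt_eqF. Qed.

(** Where the monotone function B is differentiable, it is continuous, and B s <= A t for s < t
    yields B t <= A t. One null set thus serves both for membership in [S] and for derivability of b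
    = B / t^2. *)
Lemma profile_ae_derivable : {ae mu, forall t, 0 < t < 1 -> S t /\ derivable b t 1}.
Proof.
have BB r s : 0 < r -> r <= s -> s < 1 -> B r <= B s := @profile_BB _ _ _ _ P r s.
apply: negligibleS (nondecreasing_ae_derivable01 BB) => t; apply: contra_not => dB.
move=> /[dup] t01 /andP[t0 t1]; have {}dB := dB t01; split.
  split => //; suff AB : A t = B t by apply: (mulfI _ AB); rewrite expf_neq0// gt_eqF.
  have [_ AB] := profile_AB P t01; rewrite -/(A t) -/(B t) in AB.
  apply: le_anti; rewrite AB /=; apply/ler_addgt0Pr => e e0.
  have : B @ t --> B t by exact/differentiable_continuous/derivable1_diffP.
  move=> /cvgrPdist_le/(_ e e0)/nbhs_ballP[r /= r0 Hr].
  pose s := t - Num.min t r / 2.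
  have m0 : 0 < Num.min t r by rewrite lt_min t0.
  have m1 : Num.min t r <= t by rewrite ge_min lexx.
  have m2 : Num.min t r <= r by rewrite ge_min lexx orbT.
  have s0 : 0 < s by rewrite /s; lra.
  have st : s < t by rewrite /s; lra.
  have := profile_BA P s0 st t1; rewrite -/(A t) -/(B s).
  have : `|B t - B s| <= e by apply: Hr; rewrite /ball/= ger0_norm /s; lra.
  by rewrite ler_norml => /andP[]; lra.
have dV : derivable (fun s => (s ^+ 2)^-1) t 1.
  apply: (@ex_derive _ _ _ _ _ _ _ _); apply: is_deriveV.
  by rewrite expf_neq0// gt_eqF.
apply: near_eq_derivable (derivableM dB dV); near=> s.
rewrite [RHS]bE//; apply/andP; split.
  by near: s; exact: lt_nbhsr.
by near: s; exact: lt_nbhsl.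
Unshelve. all: by end_near. Qed.

(** A set of full measure in ]0, 1[ meets every subinterval. Hence every time is an accumulation
    point of [S], and bounds on [S] can spread to all times. *)
Lemma profile_dense c d : 0 <= c -> c < d -> d <= 1 -> exists t, [/\ S t, c < t & t < d].
Proof.
move=> c0 cd d1; apply: contrapT => H.
have : mu.-negligible `]c, d[.
  apply: negligibleS profile_ae_derivable => t; rewrite /= in_itv/= => /andP[ct td] Ht.
  have [|St _] := Ht; first by rewrite (le_lt_trans c0 ct) (lt_le_trans td d1).
  by apply: H; exists t.
move=> /negligibleP => /(_ (measurable_itv _)) mu0.
have : (mu `]c, d[ = 0)%E by exact: mu0.
rewrite lebesgue_measure_itv/= lte_fin cd => /eqP.
by rewrite -EFinB eqe subr_eq0 gt_eqF.
Qed.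

Lemma profile_within_proper t : 0 < t < 1 -> ProperFilter (within S t^').
Proof.
move=> /andP[t0 t1]; apply: Build_ProperFilter => /within_dnbhsP[r r0 H].
have m0 : 0 < Num.min (1 - t) r by rewrite lt_min r0 subr_gt0 t1.
have m1 : Num.min (1 - t) r <= 1 - t by rewrite ge_min lexx.
have m2 : Num.min (1 - t) r <= r by rewrite ge_min lexx orbT.
have [s [Ss ts st]] := @profile_dense t (t + Num.min (1 - t) r) ltac:(lra) ltac:(lra) ltac:(lra).
by apply: (H s) => //; [rewrite ger0_norm; lra|rewrite gt_eqF].
Qed.

(** The difference quotients of the nondecreasing B = t^2 b are nonnegative. Solved for those of
    [b], this leaves the lower bound - b(t) (s + t) / s^2, which tends to - 2 b(t) / t. *)
Lemma profile_lower_deriv_ge t : 0 < t < 1 ->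
  ((- (2 * b t / t))%:E <= lower_deriv S b t)%E.
Proof.
move=> /[dup] t01 /andP[t0 t1]; apply/lee_addgt0Pr => e e0; rewrite -leeBlDr//.
apply: limf_einf_ge.
have : (fun s => b t * (s + t) / s ^+ 2) @ t --> b t * (t + t) / t ^+ 2.
  apply: cvgM; last by apply: cvgV; [rewrite expf_neq0// gt_eqF|exact: exprn_continuous].
  by apply: cvgM; [exact: cvg_cst|apply: cvgD; [exact: cvg_id|exact: cvg_cst]].
move=> /cvgrPdist_le/(_ e e0)/nbhs_ballP[r /= r0 Hr].
apply/within_dnbhsP; exists (Num.min r (Num.min t (1 - t))).
  by rewrite !lt_min r0 t0 subr_gt0.
move=> s; rewrite !lt_min => /and3P[sr st st1] snt Ss /=.
have := Hr s; rewrite /ball/= distrC => /(_ sr) {}Hr.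
have [/andP[s0 s1] _] := Ss.
rewrite -EFinB lee_fin.
have k0 : s - t != 0 by rewrite subr_eq0.
suff H : 0 <= (b s - b t) / (s - t) + b t * (s + t) / s ^+ 2.
  have E : b t * (t + t) / t ^+ 2 = 2 * b t / t by field; lra.
  by move: Hr; rewrite E ler_norml => /andP[]; lra.
have -> : (b s - b t) / (s - t) + b t * (s + t) / s ^+ 2 =
    (B s - B t) / (s - t) / s ^+ 2.
  by rewrite /B; field; rewrite k0 gt_eqF.
apply: mulr_ge0; last by rewrite invr_ge0 sqr_ge0.
have [ts|st'|E] := ltgtP t s; last by rewrite E subrr eqxx in k0.
- have := profile_BB P t0 (ltW ts) s1; rewrite -/(B s) -/(B t) => ?.
  by rewrite divr_ge0//; lra.
- have := profile_BB P s0 (ltW st') t1; rewrite -/(B s) -/(B t) => ?.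
  by rewrite mulr_le0// ?invr_le0; lra.
Qed.

End profile_derivatives.

(** * Parabolas below a profile *)

Section profile_peano.
Context {R : realType}.
Variables (p a b : R -> R).
Hypothesis P : profile p (fun t => t ^+ 2 * a t) (fun t => t ^+ 2 * b t).
Implicit Types (r s t u e : R).

Let A t := t ^+ 2 * a t.
Let B t := t ^+ 2 * b t.
Let S := [set t | 0 < t < 1 /\ a t = b t].

Let SAB t : S t -> A t = B t.
Proof. by rewrite /A /B => -[_ ->]. Qed.

Let sub r s : 0 < r -> r < s -> s < 1 ->
  B r * (s - r) / (r * s) <= p s - p r /\ p s - p r <= A s * (s - r) / (r * s).
Proof.
move=> r0 rs s1; have := profile_sub P r0 rs s1; rewrite -/(A s) -/(B r).
have -> : r^-1 - s^-1 = (s - r) / (r * s) by field; apply/andP; split; rewrite gt_eqF//; lra.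
by rewrite !mulrA.
Qed.

(** Before time [u] the slopes of p in the variable 1 / t are bounded by [B u], so p is Lipschitz in
    that variable. *)
Lemma profile_continuous_p t : 0 < t < 1 -> p @ t --> p t.
Proof.
move=> /[dup] t01 /andP[t0 t1]; pose u := (1 + t) / 2.
have tu : t < u by rewrite /u; lra.
have u1 : u < 1 by rewrite /u; lra.
have u01 : 0 < u < 1 by rewrite u1 (lt_trans t0).
have C0 : 0 < B u + 1.
  by have [h1 h2] := profile_AB P u01; rewrite -/(A u) -/(B u) in h1 h2; lra.
have key r s : 0 < r -> r < s -> s < u -> `|p s - p r| <= (B u + 1) * `|r^-1 - s^-1|.
  move=> r0 rs su; have s1 : s < 1 by lra.
  have r01 : 0 < r < 1 by rewrite r0 (lt_trans rs).
  have k0 : 0 < r^-1 - s^-1 by rewrite subr_gt0 ltf_pV2// posrE; lra.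
  have [h1 h2] := profile_sub P r0 rs s1; have [h3 h4] := profile_AB P r01.
  have s01 : 0 < s < 1 by rewrite s1 (lt_trans r0).
  have h5 : A s <= B u.
    by apply: le_trans (profile_AB P s01).2 _; apply: (profile_BB P); lra.
  have h6 := ler_wpM2r (ltW k0) h5.
  have h7 := mulr_ge0 (le_trans h3 h4) (ltW k0).
  rewrite [`|_^-1 - _|]gtr0_norm// ger0_norm; last exact: le_trans h7 h1.
  by rewrite -/(A s) in h2; rewrite mulrDl mul1r; lra.
have cV : (fun s => s^-1) @ t --> t^-1 by apply: cvgV; [rewrite gt_eqF|exact: cvg_id].
apply/cvgrPdist_le => e e0.
have eC : 0 < e / (B u + 1) by rewrite divr_gt0.
near=> s.
have s0 : 0 < s by near: s; exact: lt_nbhsr.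
have su : s < u by near: s; exact: lt_nbhsl.
have sV : `|t^-1 - s^-1| <= e / (B u + 1) by near: s; move/cvgrPdist_le : cV; apply.
rewrite ler_pdivlMr// mulrC in sV; apply: le_trans sV.
have [ts|st|->] := ltgtP t s; last by rewrite !subrr normr0 mulr0.
  by rewrite distrC; exact: key.
by rewrite (distrC t^-1); exact: key.
Unshelve. all: by end_near. Qed.

(** The tilt [k * (u - t)] turns weak slope inequalities into the strict increase required by
    [increasing_right_le] and [decreasing_left_ge]. *)
Let bump t v c k u := p u - v * (u - t) - c * (u - t) ^+ 2 / 2 + k * (u - t).

Let continuous_bump t v c k (r s : R) : 0 < r -> s < 1 ->
  {within `[r, s], continuous (bump t v c k)}.
Proof.
move=> r0 s1; apply: continuous_in_subspaceT => u.
rewrite inE/= in_itv/= => /andP[ru us].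
have u01 : 0 < u < 1 by rewrite (lt_le_trans r0 ru) (le_lt_trans us s1).
have ct : (fun s => s - t) @ u --> u - t by apply: cvgB; [exact: cvg_id|exact: cvg_cst].
apply: cvgD; last by apply: cvgM; [exact: cvg_cst|].
apply: cvgB; first apply: cvgB.
- exact: profile_continuous_p.
- by apply: cvgM; [exact: cvg_cst|].
- apply: cvgM; last exact: cvg_cst.
  apply: cvgM; first exact: cvg_cst.
  by rewrite expr2; apply: cvgM.
Qed.

Let near_pos (g : R -> R) u : g @ u --> g u -> 0 < g u ->
  exists2 r : R, 0 < r & forall s, `|s - u| < r -> 0 < g s.
Proof.
move=> cg gu; have /nbhs_ballP[r /= r0 Hr] : nbhs u [set s | 0 < g s].
  exact: (cvgr_gt _ cg).
by exists r => // s su; apply: Hr; rewrite /ball/= distrC.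
Qed.

Let cvg_quad t v c u : (fun s => s ^+ 2 * (v + c * (s - t))) @ u --> u ^+ 2 * (v + c * (u - t)).
Proof.
apply: cvgM; first exact: exprn_continuous.
apply: cvgD; first exact: cvg_cst.
apply: cvgM; first exact: cvg_cst.
by apply: cvgB; [exact: cvg_id|exact: cvg_cst].
Qed.

Let cvg_bracket t x v c u : 0 < u ->
  (fun w => x / (u * w) - v - c * ((w - t) + (u - t)) / 2) @ u -->
    x / (u * u) - v - c * ((u - t) + (u - t)) / 2.
Proof.
move=> u0; apply: cvgB; first apply: cvgB.
- apply: cvgM; first exact: cvg_cst.
  apply: cvgV; first by rewrite mulf_neq0// gt_eqF.
  by apply: cvgM; [exact: cvg_cst|exact: cvg_id].
- exact: cvg_cst.
- apply: cvgM; last exact: cvg_cst.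
  apply: cvgM; first exact: cvg_cst.
  apply: cvgD; last exact: cvg_cst.
  by apply: cvgB; [exact: cvg_id|exact: cvg_cst].
Qed.

(** On [S] the derivative of p is at least b(t) + c (s - t), and the conclusion is the integrated
    form. As [S] may miss times, growth is checked at every [u] through the subgradient [B u]. *)
Lemma profile_quadratic_right t (d c : R) : S t -> d <= 1 ->
  (forall s, S s -> t < s -> s < d -> b t + c * (s - t) <= b s) ->
  forall r, t < r -> r < d -> p t + b t * (r - t) + c * (r - t) ^+ 2 / 2 <= p r.
Proof.
move=> St d1 H r tr rd; have [/andP[t0 t1] _] := St.
(* Points of [S] just before [u] carry the bound to [u], because B does not decrease. *)
have claim u : t <= u -> u < d -> u ^+ 2 * (b t + c * (u - t)) <= B u.
  rewrite le_eqVlt => /predU1P[<-|tu] ud; first by rewrite subrr mulr0 addr0.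
  rewrite leNgt; apply/negP => lt.
  have [||e e0 He] := @near_pos (fun s => s ^+ 2 * (b t + c * (s - t)) - B u) u.
  - by apply: cvgB; [exact: cvg_quad|exact: cvg_cst].
  - by rewrite subr_gt0.
  have m0 : 0 < Num.min e (u - t) by rewrite lt_min e0 subr_gt0.
  have m1 : Num.min e (u - t) <= e by rewrite ge_min lexx.
  have m2 : Num.min e (u - t) <= u - t by rewrite ge_min lexx orbT.
  have [s [Ss s1 s2]] := @profile_dense _ _ _ _ P (u - Num.min e (u - t)) u ltac:(lra) ltac:(lra) ltac:(lra).
  have := He s; rewrite ltr_norml => /(_ ltac:(apply/andP; split; lra)).
  have : s ^+ 2 * (b t + c * (s - t)) <= B s.
    by rewrite ler_wpM2l ?sqr_ge0// H//; lra.
  have : B s <= B u by apply: (profile_BB P); lra.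
  lra.
apply/ler_addgt0Pr => z z0; pose k := z / (r - t).
have rt : 0 < r - t by rewrite subr_gt0.
have k0 : 0 < k by rewrite divr_gt0.
suff : bump t (b t) c k t <= bump t (b t) c k r.
  have kz : k * (r - t) = z by rewrite /k divfK// gt_eqF.
  rewrite /bump kz subrr; lra.
apply: increasing_right_le; first exact: ltW.
  by apply: continuous_bump; lra.
move=> u tu ur; have u0 : 0 < u := lt_le_trans t0 tu.
(* The increment of [bump] from [u] to [w] is at least w - u times this bracket, whose value at w =
   u is at least [k] by [claim]. *)
have [||e e0 He] := @near_pos (fun w => B u / (u * w) - b t - c * ((w - t) + (u - t)) / 2 + k) u.
- by apply: cvgD; [exact: cvg_bracket|exact: cvg_cst].
- have := claim u tu (lt_trans ur rd).
  rewrite mulrC -ler_pdivlMr ?exprn_gt0// expr2; lra.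
have m0 : 0 < Num.min e (r - u) by rewrite lt_min e0 subr_gt0.
have m1 : Num.min e (r - u) <= e by rewrite ge_min lexx.
have m2 : Num.min e (r - u) <= r - u by rewrite ge_min lexx orbT.
pose w := u + Num.min e (r - u) / 2.
have uw : u < w by rewrite /w; lra.
exists w; split => //; first by rewrite /w; lra.
have := He w; rewrite ltr_norml => /(_ ltac:(rewrite /w; apply/andP; split; lra)) Hw.
have w1 : w < 1 by move: ur rd d1 m2; rewrite /w; lra.
have [h _] := sub u0 uw w1.
rewrite -subr_gt0; apply: (@lt_le_trans _ _ ((w - u) *
  (B u / (u * w) - b t - c * ((w - t) + (u - t)) / 2 + k))).
  by rewrite mulr_gt0// subr_gt0.
have E : (w - u) * (B u / (u * w)) = B u * (w - u) / (u * w) by rewrite mulrA (mulrC (w - u)).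
rewrite /bump.
rewrite (_ : (w - u) * _ = (w - u) * (B u / (u * w)) + (w - u) * (- b t - c * ((w - t) + (u - t)) / 2 + k)); last first.
  by rewrite -mulrDr !addrA.
rewrite E; have -> : p w - b t * (w - t) - c * (w - t) ^+ 2 / 2 + k * (w - t) -
    (p u - b t * (u - t) - c * (u - t) ^+ 2 / 2 + k * (u - t)) =
    p w - p u + (w - u) * (- b t - c * ((w - t) + (u - t)) / 2 + k).
  by clearbody w k; field.
by rewrite lerD2r.
Qed.

(** Mirror image of the previous argument: [A u] replaces [B u], points of [S] are taken just after
    [u], and the tilt is [- k] because r < t. *)
Lemma profile_quadratic_left t (d c : R) : S t -> 0 <= d ->
  (forall s, S s -> d < s -> s < t -> b s <= b t + c * (s - t)) ->
  forall r, d < r -> r < t -> p t + b t * (r - t) + c * (r - t) ^+ 2 / 2 <= p r.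
Proof.
move=> St d0 H r dr rt; have [/andP[t0 t1] _] := St.
have claim u : d < u -> u <= t -> A u <= u ^+ 2 * (b t + c * (u - t)).
  move=> du; rewrite le_eqVlt => /predU1P[->|ut].
    by rewrite subrr mulr0 addr0 SAB.
  rewrite leNgt; apply/negP => lt.
  have [||e e0 He] := @near_pos (fun s => A u - s ^+ 2 * (b t + c * (s - t))) u.
  - by apply: cvgB; [exact: cvg_cst|exact: cvg_quad].
  - by rewrite subr_gt0.
  have m0 : 0 < Num.min e (t - u) by rewrite lt_min e0 subr_gt0.
  have m1 : Num.min e (t - u) <= e by rewrite ge_min lexx.
  have m2 : Num.min e (t - u) <= t - u by rewrite ge_min lexx orbT.
  have [s [Ss s1 s2]] := @profile_dense _ _ _ _ P u (u + Num.min e (t - u)) ltac:(lra) ltac:(lra) ltac:(lra).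
  have := He s; rewrite ltr_norml => /(_ ltac:(apply/andP; split; lra)).
  have : B s <= s ^+ 2 * (b t + c * (s - t)).
    by rewrite ler_wpM2l ?sqr_ge0// H//; lra.
  have [//|_ h] := @profile_AB _ _ _ _ P u; first by apply/andP; split; lra.
  have : B u <= A s by apply: (profile_BA P); lra.
  by rewrite (SAB Ss) -/(A u) -/(B u) in h *; lra.
apply/ler_addgt0Pr => z z0; pose k := z / (t - r).
have rt' : 0 < t - r by rewrite subr_gt0.
have k0 : 0 < k by rewrite divr_gt0.
suff : bump t (b t) c (- k) t <= bump t (b t) c (- k) r.
  have kz : - k * (r - t) = z by rewrite -(opprB t) mulrNN /k divfK// gt_eqF.
  rewrite /bump kz subrr; lra.
apply: decreasing_left_ge; first exact: ltW.
  by apply: continuous_bump; lra.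
move=> u ru ut; have u0 : 0 < u by lra.
have [||e e0 He] := @near_pos (fun w => k - (A u / (u * w) - b t - c * ((w - t) + (u - t)) / 2)) u.
- by apply: cvgB; [exact: cvg_cst|exact: cvg_bracket].
- have := claim u (lt_trans dr ru) ut.
  rewrite [leRHS]mulrC -ler_pdivrMr ?exprn_gt0// expr2; lra.
have m0 : 0 < Num.min e (u - r) by rewrite lt_min e0 subr_gt0.
have m1 : Num.min e (u - r) <= e by rewrite ge_min lexx.
have m2 : Num.min e (u - r) <= u - r by rewrite ge_min lexx orbT.
pose w := u - Num.min e (u - r) / 2.
have wu : w < u by rewrite /w; lra.
have w0 : 0 < w by rewrite /w; lra.
exists w; split => //; first by rewrite /w; lra.
have := He w; rewrite ltr_norml => /(_ ltac:(rewrite /w; apply/andP; split; lra)) Hw.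
have u1 : u < 1 by lra.
have [_ h] := sub w0 wu u1.
rewrite (mulrC w) in h.
rewrite -subr_gt0; apply: (@lt_le_trans _ _ ((u - w) *
  (k - (A u / (u * w) - b t - c * ((w - t) + (u - t)) / 2)))).
  by rewrite mulr_gt0// subr_gt0.
have E : (u - w) * (A u / (u * w)) = A u * (u - w) / (u * w) by rewrite mulrA (mulrC (u - w)).
rewrite /bump.
rewrite (_ : (u - w) * _ = (u - w) * (k + b t + c * ((w - t) + (u - t)) / 2) - (u - w) * (A u / (u * w))); last first.
  by rewrite -mulrBr; congr (_ * _); lra.
rewrite E; have -> : p w - b t * (w - t) - c * (w - t) ^+ 2 / 2 + - k * (w - t) -
    (p u - b t * (u - t) - c * (u - t) ^+ 2 / 2 + - k * (u - t)) =
    (u - w) * (k + b t + c * ((w - t) + (u - t)) / 2) - (p u - p w).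
  by clearbody w k; field.
by rewrite lerD2l lerN2.
Qed.

End profile_peano.

(** * Reversal of time and touching functions *)

Section reparametrization.
Context {R : realType}.
Implicit Types (f g : R -> R) (t v : R) (S : set R).

Lemma limf_esup_comp (h : R -> R) (F G : set_system R) (f : R -> \bar R) :
  Filter F -> Filter G -> (forall V, G V <-> F (h @^-1` V)) ->
  limf_esup (f \o h) F = limf_esup f G.
Proof.
move=> FF FG FG'; apply/eqP; rewrite eq_le; apply/andP.
split; apply: lee_of_gt_fin => c /limf_esup_lt H; apply: limf_esup_le.
  by move/FG' : H; apply: filterS => s /= /ltW.
by apply/FG'; apply: filterS H => s /= /ltW.
Qed.

Lemma dnbhs0N (V : set R) : 0^' V <-> 0^' (-%R @^-1` V).
Proof.
split=> /dnbhsP[r r0 H]; apply/dnbhsP; exists r => // y yr y0 /=.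
  by apply: H; rewrite ?oppr_eq0// subr0 normrN; rewrite subr0 in yr.
by rewrite -[y]opprK; apply: H; rewrite ?oppr_eq0// subr0 normrN; rewrite subr0 in yr.
Qed.

Lemma within_dnbhs1B S t (V : set R) :
  (within S (1 - t)^') V <-> (within [set r | S (1 - r)] t^') ((fun r => 1 - r) @^-1` V).
Proof.
split=> /within_dnbhsP[r r0 H]; apply/within_dnbhsP; exists r => // y yr yt Sy /=.
  apply: H => //; last by rewrite (inj_eq (addrI _)) eqr_opp.
  by rewrite (_ : _ - _ = - (y - t)) ?normrN//; lra.
have -> : y = 1 - (1 - y) by lra.
apply: H => //=.
- by rewrite (_ : _ - _ = - (y - (1 - t))) ?normrN//; lra.
- by apply: contra_neq yt; lra.
- by rewrite (_ : 1 - _ = y)//; lra.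
Qed.

Lemma is_derive_1B f t v : is_derive (1 - t) 1 f v ->
  is_derive t 1 (fun r => - f (1 - r)) v.
Proof.
move=> /slope_is_derive H; apply: is_derive_slope => e e0.
have /nbhs_ballP[r /= r0 Hr] := H e e0.
apply/nbhs_ballP; exists r => // s; rewrite /ball/= => st.
have E : 1 - s - (1 - t) = - (s - t) by lra.
have /Hr : ball (1 - t) r (1 - s) by rewrite /ball/= distrC E normrN distrC.
rewrite E normrN mulrN opprK => Hs.
have -> : - f (1 - s) - - f (1 - t) - v * (s - t) =
    - (f (1 - s) - f (1 - t) + v * (s - t)) by ring.
by rewrite normrN.
Qed.

(** Reversal changes the sign of s - t, hence of the difference quotients, and so exchanges upper
    and lower derivatives. *)
Lemma upper_deriv_1B S g t :
  upper_deriv [set r | S (1 - r)] (fun r => g (1 - r)) t = (- lower_deriv S g (1 - t))%E.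
Proof.
rewrite /upper_deriv /lower_deriv -limf_esupN.
rewrite -(limf_esup_comp _ _ _ (within_dnbhs1B S t)).
congr limf_esup; apply/funext => s /=; congr EFin.
have -> : 1 - s - (1 - t) = - (s - t) by lra.
by rewrite invrN mulrN opprK.
Qed.

Lemma lower_deriv_1B S g t :
  lower_deriv [set r | S (1 - r)] (fun r => g (1 - r)) t = (- upper_deriv S g (1 - t))%E.
Proof.
have := upper_deriv_1B [set r | S (1 - r)] (fun r => g (1 - r)) (1 - t).
have E (r : R) : 1 - (1 - r) = r by lra.
rewrite /= (_ : [set r | S (1 - (1 - r))] = S); last first.
  by apply/seteqP; split=> r /=; rewrite E.
rewrite (_ : (fun r => g (1 - (1 - r))) = g); last by apply/funext => r; rewrite E.
by rewrite E => ->; rewrite oppeK.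
Qed.

(** Reversal preserves e^2, and the sign in front of [f] changes that of the remainder. The
    derivative hypothesis identifies the [derive1] terms on the two sides. *)
Lemma upper_peano2_1B f t v : is_derive (1 - t) 1 f v ->
  upper_peano2 (fun r => - f (1 - r)) t = (- lower_peano2 f (1 - t))%E.
Proof.
move=> df; have dg := is_derive_1B df.
rewrite /upper_peano2 /lower_peano2 -limf_esupN.
rewrite -(limf_esup_comp _ _ _ dnbhs0N).
congr limf_esup; apply/funext => e /=; congr EFin.
rewrite sqrrN -mulNr; congr (_ / _).
rewrite /peano_rem !derive1E !derive_val /=.
have -> : 1 - (t - e) = 1 - t + e by lra.
by lra.
Qed.

Lemma lower_peano2_1B f t v : is_derive (1 - t) 1 f v ->
  lower_peano2 (fun r => - f (1 - r)) t = (- upper_peano2 f (1 - t))%E.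
Proof.
move=> df; have dg := is_derive_1B df.
have E (r : R) : 1 - (1 - r) = r by lra.
have : is_derive (1 - (1 - t)) 1 (fun r => - f (1 - r)) v by rewrite E.
move=> /upper_peano2_1B; rewrite E.
rewrite (_ : (fun r => - - f (1 - (1 - r))) = f); last first.
  by apply/funext => r; rewrite E opprK.
by move=> ->; rewrite oppeK.
Qed.

Section touching.
Variables (f g : R -> R) (t : R).
Hypotheses (fg : \forall s \near t, f s <= g s) (fgt : f t = g t).
Hypothesis dfg : derive1 f t = derive1 g t.

Let touching_rem :
  0^' [set e | ((peano_rem f t e / e ^+ 2)%:E <= (peano_rem g t e / e ^+ 2)%:E)%E].
Proof.
have /nbhs_ballP[r /= r0 H] := fg; apply/dnbhsP; exists r => // e.
rewrite subr0 => er e0 /=; rewrite lee_fin ler_wpM2r ?invr_ge0 ?sqr_ge0//.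
have : f (t + e) <= g (t + e) by apply: H; rewrite /ball/= opprD addNKr normrN.
by rewrite /peano_rem dfg fgt; lra.
Qed.

Lemma touching_lower_peano2 : (lower_peano2 f t <= lower_peano2 g t)%E.
Proof. exact: le_limf_einf touching_rem. Qed.

Lemma touching_upper_peano2 : (upper_peano2 f t <= upper_peano2 g t)%E.
Proof. exact: le_limf_esup touching_rem. Qed.

End touching.

End reparametrization.

(** * Second Peano derivatives against derivatives of the slope *)

Section profile_peano2.
Context {R : realType}.
Variables (p a b : R -> R).
Hypothesis P : profile p (fun t => t ^+ 2 * a t) (fun t => t ^+ 2 * b t).
Implicit Types (r s t u e : R).

Let A t := t ^+ 2 * a t.
Let B t := t ^+ 2 * b t.
Let S := [set t | 0 < t < 1 /\ a t = b t].

Let SAB t : S t -> A t = B t.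
Proof. by rewrite /A /B => -[_ ->]. Qed.

(** A real c below the lower derivative bounds the secants of [b] at [t] on both sides, which puts a
    parabola with second derivative c below p near [t]. *)
Lemma profile_lower_deriv_le_peano2 t : S t ->
  (lower_deriv S b t <= lower_peano2 p t)%E.
Proof.
move=> St; have [/andP[t0 t1] _] := St; have dp := profile_is_derive P St.
apply: lee_of_lt_fin => c /limf_einf_gt/within_dnbhsP[r r0 H].
apply: limf_einf_ge; apply/dnbhsP.
exists (Num.min r (Num.min t (1 - t))); first by rewrite !lt_min r0 t0 subr_gt0.
set m := Num.min r _.
have mr : m <= r by rewrite ge_min lexx.
have mt : m <= t by rewrite !ge_min lexx orbT.
have m1 : m <= 1 - t by rewrite !ge_min lexx !orbT.
move=> e; rewrite subr0 => em e0 /=; rewrite lee_fin ler_pdivlMr ?exprn_even_gt0//.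
rewrite /peano_rem derive1E derive_val.
suff : p t + b t * (t + e - t) + c * (t + e - t) ^+ 2 / 2 <= p (t + e).
  by rewrite (addrC t) addrK; lra.
have e0' : e < 0 \/ 0 < e by move: e0; case: ltgtP => //; [left|right].
case: e0' => [en|ep].
- apply: (@profile_quadratic_left _ _ _ _ P t (t - m)) => //; first by lra.
  + move=> s Ss ms st; have := H s; rewrite ltr0_norm; last by lra.
    move=> /(_ ltac:(lra) ltac:(by rewrite lt_eqF) Ss) /=.
    by rewrite lte_fin ltr_ndivlMr ?subr_lt0//; lra.
  + by rewrite ltr0_norm// in em; lra.
  + by lra.
- apply: (@profile_quadratic_right _ _ _ _ P t (t + m)) => //; first by lra.
  + move=> s Ss ts sm; have := H s; rewrite gtr0_norm; last by lra.
    move=> /(_ ltac:(lra) ltac:(by rewrite gt_eqF) Ss) /=.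
    by rewrite lte_fin ltr_pdivlMr ?subr_gt0//; lra.
  + by lra.
  + by rewrite gtr0_norm// in em; lra.
Qed.

(* The chord of [p] over [[t + e, t + 2 e]] is compared with the parabola at
   [t + 2 e]; this is where the factor [2] comes from. *)
Lemma profile_upper_deriv_le_peano2 t (c : R) : S t -> (upper_peano2 p t < c%:E)%E ->
  (upper_deriv S b t <= (2 * c + 2 * b t / t)%:E)%E.
Proof.
move=> St; have [/andP[t0 t1] _] := St; have dp := profile_is_derive P St.
move=> /limf_esup_lt/dnbhsP[r r0 H].
apply/lee_addgt0Pr => z z0; apply: limf_esup_le.
pose v := b t.
(* The bound reached for the difference quotient at [s], together with its limit at [t]. *)
have : (fun s => 2 * v / s + 2 * c + (s - t) / s * (v / s + 2 * c)) @ t -->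
    2 * v / t + 2 * c + (t - t) / t * (v / t + 2 * c).
  have cV : (fun s => s^-1) @ t --> t^-1 by apply: cvgV; [rewrite gt_eqF|exact: cvg_id].
  apply: cvgD; first by apply: cvgD; [apply: cvgM; [exact: cvg_cst|exact: cV]|exact: cvg_cst].
  apply: cvgM; first by apply: cvgM => //; apply: cvgB; [exact: cvg_id|exact: cvg_cst].
  by apply: cvgD; [apply: cvgM; [exact: cvg_cst|exact: cV]|exact: cvg_cst].
move=> /cvgrPdist_le/(_ z z0)/nbhs_ballP[r' /= r'0 Hr'].
(* Halving keeps t + 2 e inside the Peano neighbourhood and inside ]0, 1[. *)
apply/within_dnbhsP; exists (Num.min r' (Num.min r (Num.min t (1 - t)) / 2)).
  by rewrite !lt_min r'0 divr_gt0// !lt_min r0 t0 subr_gt0.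
set m := Num.min r (Num.min t (1 - t)).
have mr : m <= r by rewrite ge_min lexx.
have mt : m <= t by rewrite !ge_min lexx orbT.
have m1 : m <= 1 - t by rewrite !ge_min lexx !orbT.
move=> s; rewrite lt_min => /andP[sr sm] snt Ss /=.
rewrite -EFinD lee_fin.
have := Hr' s; rewrite /ball/= distrC => /(_ sr); rewrite subrr mul0r mul0r addr0.
rewrite ler_norml => /andP[Hz _].
suff : (b s - b t) / (s - t) <= 2 * v / s + 2 * c + (s - t) / s * (v / s + 2 * c).
  by rewrite /v in Hz *; lra.
have [/andP[s0 s1] _] := Ss.
pose e := s - t; have e0 : e != 0 by rewrite subr_eq0.
have sE : s = t + e by rewrite /e; lra.
rewrite -/e in sm *.
have se : 0 < s + e /\ s + e < 1.
  by move: sm; rewrite ltr_norml => /andP[? ?]; rewrite sE; split; lra.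
case: se => se0 se1.
have : p (s + e) <= p t + 2 * e * v + 2 * c * e ^+ 2.
  have := H (2 * e); rewrite subr0 normrM ger0_norm// mulf_neq0// => /(_ ltac:(lra) isT) /=.
  rewrite lte_fin /peano_rem derive1E derive_val ltr_pdivrMr; last first.
    by rewrite exprn_even_gt0// mulf_neq0.
  have -> : t + 2 * e = s + e by rewrite sE; lra.
  by rewrite exprMn /v; lra.
have kE (x y : R) : 0 < x -> 0 < y -> x^-1 - y^-1 = (y - x) / (x * y).
  by move=> x0 y0; field; rewrite !gt_eqF.
have At : A t = t ^+ 2 * v by rewrite (SAB St).
have As : A s = s ^+ 2 * b s by rewrite (SAB Ss).
(* e Y is a lower bound for the increment of p from s to s + e = t + 2 e; e X is what the Peano
   bound at t + 2 e leaves after subtracting e v t / s, a lower bound for the increment from t to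
   s. *)
pose X := 2 * v + 2 * c * e - v * t / s; pose Y := b s * (s / (s + e)).
move=> Hp; have XY : e * Y <= e * X.
  have e0' : e < 0 \/ 0 < e by move: e0; case: ltgtP => //; [left|right].
  case: e0' => [en|ep].
  - have ses : s + e < s by lra.
    have st : s < t by lra.
    have [_ h1] := profile_sub P se0 ses s1; have [_ h2] := profile_sub P s0 st t1.
    rewrite -/(A s) As in h1; rewrite -/(A t) At in h2.
    have h3 : s ^+ 2 * b s * ((s + e)^-1 - s^-1) = - (e * Y).
      by rewrite kE// /Y; field; rewrite !gt_eqF.
    have h4 : t ^+ 2 * v * (s^-1 - t^-1) = - e * v * t / s.
      by rewrite kE// sE; field; rewrite -sE !gt_eqF.
    rewrite /X; lra.
  - have ses : s < s + e by lra.
    have ts : t < s by lra.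
    have [h1 _] := profile_sub P s0 ses se1; have [h2 _] := profile_sub P t0 ts s1.
    have h3 : s ^+ 2 * b s * (s^-1 - (s + e)^-1) = e * Y.
      by rewrite kE// /Y; field; rewrite !gt_eqF.
    have h4 : t ^+ 2 * v * (t^-1 - s^-1) = e * v * t / s.
      by rewrite kE// sE; field; rewrite -sE !gt_eqF.
    rewrite -/v in h2; rewrite /X; lra.
rewrite -subr_ge0 -/v.
have -> : 2 * v / s + 2 * c + e / s * (v / s + 2 * c) - (b s - v) / e =
    (s + e) / s * (e * X - e * Y) / e ^+ 2.
  have tE : t = s - e by rewrite sE; lra.
  rewrite /X /Y; clearbody e v; rewrite tE; field.
  by rewrite e0 !gt_eqF.
apply: divr_ge0; last exact: sqr_ge0.
by apply: mulr_ge0; [rewrite divr_ge0// ltW|rewrite subr_ge0].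
Qed.

End profile_peano2.

(** * Kantorovich potentials *)

Section kantorovich.
Context {R : realType} {X : metricType R}.
Variable phi : X -> R.
Hypothesis phiK : Kantorovich_potential (EFin \o phi).
Implicit Types (x y z : X) (t s : R).

Lemma cconj_le x y : (cconj phi y <= (mdist y x ^+ 2 / 2 - phi x)%:E)%E.
Proof. by apply: ereal_inf_lbound; exists x => //=; rewrite EFinB. Qed.

(** Where [psi] is not -oo it is real, because [phi] is; there phi^c lies between psi and d^2 / 2 -
    phi. One such point suffices for the hypotheses of the Hopf-Lax section. *)
Lemma cconj_fin_ex : exists y (c : R), cconj phi y = c%:E.
Proof.
have [_ [x0 _] [psi phiE]] := phiK.
have phi_le x y : ((phi x)%:E <= (mdist x y ^+ 2 / 2)%:E - psi y)%E.
  by rewrite -[(phi x)%:E]/((EFin \o phi) x) phiE; apply: ereal_inf_lbound; exists y.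
have [y0 py0] : exists y, psi y != -oo%E.
  apply: contrapT => /forallNP H.
  have : ((EFin \o phi) x0 = +oo)%E.
    rewrite phiE; apply/eqP; rewrite -leye_eq; apply: le_ereal_inf_tmp => _ [y _ <-].
    by have /negP/negPn/eqP -> := H y.
  by [].
exists y0.
have [r pr] : exists r, psi y0 = r%:E.
  move: py0 (phi_le x0 y0); case: (psi y0) => [r|//|//]; first by exists r.
suff : cconj phi y0 \is a fin_num by move=> /fineK <-; exists (fine (cconj phi y0)).
rewrite fin_numElt; apply/andP; split.
  apply: (@lt_le_trans _ _ r%:E); first exact: ltNyr.
  apply: le_ereal_inf_tmp => _ [x _ <-] /=; have := phi_le x y0; rewrite pr -!EFinB !lee_fin.
  by rewrite (metric_sym x); lra.
by apply: le_lt_trans (cconj_le x0 y0) _; exact: ltry.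
Qed.

Lemma opp_pot_lb : exists y0 (a : R), forall y, ((a - mdist y0 y ^+ 2 / 2)%:E <= opp_pot phi y)%E.
Proof.
have [y0 [c cE]] := cconj_fin_ex; exists y0, c => y; have := cconj_le y y0.
by rewrite cE /opp_pot -EFinN !lee_fin; lra.
Qed.

Lemma opp_pot_ub : exists z, (opp_pot phi z < +oo)%E.
Proof. by have [y0 _] := cconj_fin_ex; exists y0; rewrite /opp_pot -EFinN ltry. Qed.

Lemma opp_conj_lb : exists y0 (a : R), forall y, ((a - mdist y0 y ^+ 2 / 2)%:E <= opp_conj phi y)%E.
Proof.
have [x0 _] := cconj_fin_ex; exists x0, (phi x0) => y; have := cconj_le x0 y.
by rewrite /opp_conj leeNr -EFinN opprB (metric_sym x0).
Qed.

Lemma opp_conj_ub : exists z, (opp_conj phi z < +oo)%E.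
Proof. by have [y0 [c cE]] := cconj_fin_ex; exists y0; rewrite /opp_conj cE -EFinN ltry. Qed.

Lemma phitE t x : t != 0 -> phit phi t x = - fine (Q t (opp_pot phi) x).
Proof. by rewrite /phit /phit_e => /negbTE ->; rewrite fineN. Qed.

Lemma phibartE t x : t != 1 -> phibart phi t x = fine (Q (1 - t) (opp_conj phi) x).
Proof. by rewrite /phibart /phibart_e => /negbTE ->. Qed.

(** Two inequalities are chained: phi(y) + phi^c(z) <= d(y, z)^2 / 2 and, by convexity of the
    square, d(y, z)^2 / 2 <= d(x, y)^2 / (2 t) + d(x, z)^2 / (2 (1 - t)). *)
Lemma phit_le_phibart t x : 0 < t < 1 -> phit phi t x <= phibart phi t x.
Proof.
move=> t01; have /andP[t0 t1] := t01.
have s01 : 0 < 1 - t < 1 by apply/andP; split; lra.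
rewrite phitE ?gt_eqF// phibartE ?lt_eqF// lerNl -lee_fin EFinN.
have Qf := Q_fin_num x opp_pot_lb opp_pot_ub t01.
have Qb := Q_fin_num x opp_conj_lb opp_conj_ub s01.
rewrite (fineK Qf) (fineK Qb); apply: le_ereal_inf_tmp => _ [y _ <-].
rewrite leeNl; apply: le_ereal_inf_tmp => _ [z _ <-].
rewrite leeNl /Qfun /opp_pot /opp_conj -EFinN -EFinD.
have := cconj_le y z; case: (cconj phi z) => [c|//|_]; last by rewrite /= leNye.
rewrite -EFinN !lee_fin => Hc.
have d0 := mdist_ge0 z y.
have tri : mdist z y <= mdist x y + mdist x z.
  by rewrite (le_trans (metric_triangle z x y))// addrC (metric_sym z).
have : mdist z y ^+ 2 <= (mdist x y + mdist x z) ^+ 2 by rewrite ler_sqr ?nnegrE//; lra.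
set u := mdist x y in tri *; set v := mdist x z in tri *.
have : 0 <= ((1 - t) * u - t * v) ^+ 2 / (2 * t * (1 - t)).
  by rewrite divr_ge0 ?sqr_ge0// !mulr_ge0//; lra.
have -> : ((1 - t) * u - t * v) ^+ 2 / (2 * t * (1 - t)) =
    u ^+ 2 / (2 * t) + v ^+ 2 / (2 * (1 - t)) - (u + v) ^+ 2 / 2.
  by field; rewrite !gt_eqF//; lra.
lra.
Qed.

Let a x t : R := fine (ellm phi t x) ^+ 2 / 2.
Let a' x t : R := fine (Dminus (opp_conj phi) x t * (t^-1)%:E)%E ^+ 2 / 2.
Let b' x t : R := fine (Dplus (opp_conj phi) x t * (t^-1)%:E)%E ^+ 2 / 2.
(** Reversed and negated, [phibart] becomes - Q_t of - phi^c, to which the theory of profiles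
    applies. *)
Let q x t : R := - phibart phi (1 - t) x.

Lemma profile_phit x :
  profile (fun t => phit phi t x) (fun t => t ^+ 2 * a x t) (fun t => t ^+ 2 * ellsq phi x t).
Proof.
have [P1 P2 P3 P4] := speed_profile x opp_pot_lb opp_pot_ub; split => //.
move=> r s r0 rs s1; rewrite !phitE ?gt_eqF//; first exact: P2.
exact: lt_trans rs.
Qed.

Lemma profile_phibart x :
  profile (q x) (fun t => t ^+ 2 * a' x t) (fun t => t ^+ 2 * b' x t).
Proof.
have [P1 P2 P3 P4] := speed_profile x opp_conj_lb opp_conj_ub; split => //.
move=> r s r0 rs s1.
have E t : 0 < t -> phibart phi (1 - t) x = fine (Q t (opp_conj phi) x).
  by move=> t0; rewrite phibartE ?subKr// lt_eqF// gtrBl.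
by rewrite /q !E//; [exact: P2|exact: lt_trans rs].
Qed.

Lemma ellbarsqE x t : ellbarsq phi x t = b' x (1 - t).
Proof. by []. Qed.

Lemma Dell_atE x : Dell_at phi x = [set t | 0 < t < 1 /\ a x t = ellsq phi x t].
Proof.
apply/seteqP; split=> t [t01 /= H]; split => //.
  exact: (speed_eqP x opp_pot_lb opp_pot_ub t01).1.
exact: (speed_eqP x opp_pot_lb opp_pot_ub t01).2.
Qed.

Lemma Dellbar_atE x :
  Dellbar_at phi x = [set t | [set s | 0 < s < 1 /\ a' x s = b' x s] (1 - t)].
Proof.
apply/seteqP; split=> t [/= /andP[t0 t1] H].
  have s01 : 0 < 1 - t < 1 by apply/andP; split; lra.
  by split => //; exact: (speed_eqP x opp_conj_lb opp_conj_ub s01).1.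
have s01 : 0 < 1 - t < 1 by rewrite t0 t1.
split; first by move=> /=; apply/andP; split; lra.
exact: (speed_eqP x opp_conj_lb opp_conj_ub s01).2.
Qed.

Lemma Gphi_conj g : Gphi phi g ->
  cconj phi (g 1) = (len g ^+ 2 / 2 - phi (g 0))%:E.
Proof.
move=> [_]; have := cconj_le (g 0) (g 1).
case: (cconj phi (g 1)) => [c _|//|//]; rewrite -EFinD => -[] H.
by congr EFin; lra.
Qed.

Lemma Gphi_dist g t : Gphi phi g -> 0 < t < 1 ->
  mdist (g t) (g 0) = t * len g /\ mdist (g t) (g 1) = (1 - t) * len g.
Proof.
move=> [gG _] /andP[t0 t1]; have t01 : 0 <= t <= 1 by rewrite !ltW.
split; rewrite gG ?lexx ?ler01//; congr (_ * _).
  by rewrite subr0 gtr0_norm.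
by rewrite ltr0_norm ?subr_lt0// opprB.
Qed.

Lemma Gphi_forward g t : Gphi phi g -> 0 < t < 1 ->
  [/\ Q t (opp_pot phi) (g t) = (len g ^+ 2 / 2 - phi (g 0) - (1 - t) * len g ^+ 2 / 2)%:E,
      Dplus (opp_pot phi) (g t) t = (t * len g)%:E &
      Dminus (opp_pot phi) (g t) t = (t * len g)%:E].
Proof.
move=> Gg t01; have [d0 d1] := Gphi_dist Gg t01; have cE := Gphi_conj Gg.
apply: (Q_intermediate_point opp_pot_lb opp_pot_ub (z := g 0)) => //.
  by rewrite /opp_pot -EFinN; congr EFin; lra.
move=> y; have := cconj_le y (g 1); rewrite cE /opp_pot -EFinN !lee_fin => H.
have : mdist (g 1) y ^+ 2 <= (mdist (g t) y + (1 - t) * len g) ^+ 2.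
  rewrite ler_sqr ?nnegrE ?mdist_ge0//; last by rewrite addr_ge0 ?mdist_ge0// -d1 mdist_ge0.
  by rewrite -d1 (metric_sym (g t) (g 1)) addrC metric_triangle.
lra.
Qed.

(** The same argument from the other end of the geodesic, with c = phi(g 0) and z = g 1. *)
Lemma Gphi_backward g t : Gphi phi g -> 0 < t < 1 ->
  [/\ Q (1 - t) (opp_conj phi) (g t) = (phi (g 0) - t * len g ^+ 2 / 2)%:E,
      Dplus (opp_conj phi) (g t) (1 - t) = ((1 - t) * len g)%:E &
      Dminus (opp_conj phi) (g t) (1 - t) = ((1 - t) * len g)%:E].
Proof.
move=> Gg t01; have [d0 d1] := Gphi_dist Gg t01; have cE := Gphi_conj Gg.
have s01 : 0 < 1 - t < 1 by case/andP: t01 => ? ?; apply/andP; split; lra.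
have E : 1 - (1 - t) = t by lra.
have := @Q_intermediate_point _ _ (opp_conj phi) (g t) opp_conj_lb opp_conj_ub
  (1 - t) (len g) (phi (g 0)) (g 1) s01 d1; rewrite E; apply.
  by rewrite /opp_conj cE -EFinN; congr EFin; lra.
move=> y; have := cconj_le (g 0) y; rewrite /opp_conj leeNr -EFinN.
move/le_trans; apply; rewrite lee_fin.
have : mdist y (g 0) ^+ 2 <= (mdist (g t) y + t * len g) ^+ 2.
  rewrite ler_sqr ?nnegrE ?mdist_ge0//; last by rewrite addr_ge0 ?mdist_ge0// -d0 mdist_ge0.
  by rewrite -d0 (metric_sym (g t) y) metric_triangle.
lra.
Qed.

Lemma Gphi_speeds g t : Gphi phi g -> 0 < t < 1 ->
  [/\ ellp phi t (g t) = (len g)%:E, ellm phi t (g t) = (len g)%:E,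
      ellbarp phi t (g t) = (len g)%:E & ellbarm phi t (g t) = (len g)%:E].
Proof.
move=> Gg t01; have [_ Dp Dm] := Gphi_forward Gg t01; have [_ Bp Bm] := Gphi_backward Gg t01.
have /andP[t0 t1] := t01.
have E (s : R) : 0 < s -> s * len g / s = len g by move=> s0; rewrite mulrC mulKf// gt_eqF.
have s0 : 0 < 1 - t by lra.
by split; rewrite /ellp /ellm /ellbarp /ellbarm ?Dp ?Dm ?Bp ?Bm -EFinM E.
Qed.

Lemma Gphi_phit g t : Gphi phi g -> 0 < t < 1 ->
  phit phi t (g t) = phibart phi t (g t).
Proof.
move=> Gg t01; have [QE _ _] := Gphi_forward Gg t01; have [BE _ _] := Gphi_backward Gg t01.
have /andP[t0 t1] := t01.
by rewrite phitE ?gt_eqF// phibartE ?lt_eqF// QE BE /=; lra.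
Qed.

Lemma Gphi_ell g t : Gphi phi g -> 0 < t < 1 -> ell phi t (g t) = len g /\ ellbar phi t (g t) = len g.
Proof. by move=> Gg t01; have [Ep _ Bp _] := Gphi_speeds Gg t01; rewrite /ell /ellbar Ep Bp. Qed.

(* [c]-cyclical monotonicity of the endpoint pairs, with the crossed distances
   estimated through the meeting point. *)
Lemma Gphi_cyclic g h t s : Gphi phi g -> Gphi phi h -> 0 < t < 1 -> 0 < s < 1 ->
  g t = h s ->
  t * (1 - t) * len g ^+ 2 + s * (1 - s) * len h ^+ 2 <=
    len g * len h * (t * (1 - s) + s * (1 - t)).
Proof.
move=> Gg Gh t01 s01 gh.
have [g0 g1] := Gphi_dist Gg t01; have [h0 h1] := Gphi_dist Gh s01.
have := cconj_le (g 0) (h 1); have := cconj_le (h 0) (g 1).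
rewrite (Gphi_conj Gg) (Gphi_conj Gh) !lee_fin => H1 H2.
have : mdist (g 1) (h 0) ^+ 2 <= ((1 - t) * len g + s * len h) ^+ 2.
  rewrite ler_sqr ?nnegrE ?mdist_ge0//.
    by rewrite -g1 -h0 (metric_sym (g t)) gh metric_triangle.
  by rewrite -g1 -h0 addr_ge0 ?mdist_ge0.
have : mdist (h 1) (g 0) ^+ 2 <= ((1 - s) * len h + t * len g) ^+ 2.
  rewrite ler_sqr ?nnegrE ?mdist_ge0//.
    by rewrite -h1 -g0 (metric_sym (h s)) gh metric_triangle.
  by rewrite -h1 -g0 addr_ge0 ?mdist_ge0.
rewrite !expr2; lra.
Qed.

Lemma Gint_cyclic x t s : Gint phi x t -> Gint phi x s ->
  t * (1 - t) * ell phi t x ^+ 2 + s * (1 - s) * ell phi s x ^+ 2 <=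
    ell phi t x * ell phi s x * (t * (1 - s) + s * (1 - t)).
Proof.
move=> [t01 [g Gg gx]] [s01 [h Gh hx]].
have := Gphi_cyclic Gg Gh t01 s01 (etrans gx (esym hx)).
have [gl _] := Gphi_ell Gg t01; have [hl _] := Gphi_ell Gh s01.
by rewrite -gl -hl gx hx.
Qed.

Lemma Gint_ell_ge0 x t : Gint phi x t -> 0 <= ell phi t x.
Proof.
by move=> [t01 [g Gg <-]]; have [-> _] := Gphi_ell Gg t01; exact: mdist_ge0.
Qed.

Let S x := [set t | 0 < t < 1 /\ a x t = ellsq phi x t].
Let T x := [set s | 0 < s < 1 /\ a' x s = b' x s].

Lemma Gint_Dell x t : Gint phi x t -> Dell_at phi x t /\ Dellbar_at phi x t.
Proof.
move=> [t01 [g Gg <-]]; have [Ep Em Bp Bm] := Gphi_speeds Gg t01.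
by split; split => //=; rewrite ?Ep ?Em ?Bp ?Bm.
Qed.

Let Gint_S x t : Gint phi x t -> S x t.
Proof. by move=> /Gint_Dell[+ _]; rewrite Dell_atE. Qed.

Let Gint_T x t : Gint phi x t -> T x (1 - t).
Proof. by move=> /Gint_Dell[_]; rewrite Dellbar_atE. Qed.

Lemma Gint_ellbar x t : Gint phi x t -> ell phi t x = ellbar phi t x.
Proof. by move=> [t01 [g Gg <-]]; have [-> ->] := Gphi_ell Gg t01. Qed.

Lemma Gint_ellsq x t : Gint phi x t -> ellsq phi x t = ellbarsq phi x t.
Proof. by rewrite /ellsq /ellbarsq => /Gint_ellbar ->. Qed.

Lemma Gint_phit x t : Gint phi x t -> phit phi t x = phibart phi t x.
Proof. by move=> [t01 [g Gg <-]]; exact: Gphi_phit. Qed.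

Let phibart_q x : (fun r => phibart phi r x) = (fun r => - q x (1 - r)).
Proof.
by apply/funext => r; rewrite /q opprK; congr (phibart phi _ x); lra.
Qed.

Lemma is_derive_phit x t : Gint phi x t ->
  is_derive t 1 (fun r => phit phi r x) (ellsq phi x t).
Proof. by move=> /Gint_S; exact: (profile_is_derive (profile_phit x)). Qed.

Let is_derive_q x t : Gint phi x t -> is_derive (1 - t) 1 (q x) (ellsq phi x t).
Proof.
move=> /[dup] /Gint_ellsq -> /Gint_T; rewrite ellbarsqE.
exact: (profile_is_derive (profile_phibart x)).
Qed.

Lemma is_derive_phibart x t : Gint phi x t ->
  is_derive t 1 (fun r => phibart phi r x) (ellsq phi x t).
Proof. by move=> /is_derive_q /is_derive_1B; rewrite -phibart_q. Qed.

Let Gint01 x t : Gint phi x t -> 0 < t /\ t < 1.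
Proof. by case=> /andP[]. Qed.

Lemma lower_deriv_ellsq_ge x t : Gint phi x t ->
  ((- (2 * ellsq phi x t / t))%:E <= lower_deriv (Dell_at phi x) (ellsq phi x) t)%E.
Proof.
move=> [t01 _]; rewrite Dell_atE.
exact: (profile_lower_deriv_ge (profile_phit x)).
Qed.

Lemma lower_deriv_ellsq_le x t : Gint phi x t ->
  (lower_deriv (Dell_at phi x) (ellsq phi x) t
     <= lower_peano2 (fun r => phit phi r x) t)%E.
Proof.
move=> /Gint_S St; rewrite Dell_atE.
exact: (profile_lower_deriv_le_peano2 (profile_phit x)).
Qed.

Lemma upper_deriv_ellbarsq_ge x t : Gint phi x t ->
  (upper_peano2 (fun r => phibart phi r x) t
     <= upper_deriv (Dellbar_at phi x) (ellbarsq phi x) t)%E.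
Proof.
move=> Gt; rewrite Dellbar_atE phibart_q (upper_peano2_1B (is_derive_q Gt)).
rewrite (upper_deriv_1B (T x) (b' x)) leeN2.
exact: (profile_lower_deriv_le_peano2 (profile_phibart x) (Gint_T Gt)).
Qed.

Lemma upper_deriv_ellbarsq_le x t : Gint phi x t ->
  (upper_deriv (Dellbar_at phi x) (ellbarsq phi x) t
     <= (2 * ellsq phi x t / (1 - t))%:E)%E.
Proof.
move=> Gt; have [s01 _] := Gint_T Gt; rewrite Dellbar_atE (upper_deriv_1B (T x) (b' x)).
rewrite leeNl (Gint_ellsq Gt) ellbarsqE -EFinN.
exact: (profile_lower_deriv_ge (profile_phibart x)).
Qed.

Let touching x t : Gint phi x t ->
  \forall s \near t, phit phi s x <= phibart phi s x.
Proof.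
move=> /Gint01[t0 t1]; near=> s; apply: phit_le_phibart; apply/andP; split.
  by near: s; exact: lt_nbhsr.
by near: s; exact: lt_nbhsl.
Unshelve. all: by end_near. Qed.

Let derive1_touching x t : Gint phi x t ->
  derive1 (fun r => phit phi r x) t = derive1 (fun r => phibart phi r x) t.
Proof.
move=> Gt; have := is_derive_phit Gt; have := is_derive_phibart Gt => h1 h2.
by rewrite !derive1E !derive_val.
Qed.

Lemma lower_peano2_phit_le x t : Gint phi x t ->
  (lower_peano2 (fun r => phit phi r x) t <= lower_peano2 (fun r => phibart phi r x) t)%E.
Proof.
by move=> Gt; apply: touching_lower_peano2 (touching Gt) (Gint_phit Gt) (derive1_touching Gt).
Qed.

Lemma upper_peano2_phit_le x t : Gint phi x t ->
  (upper_peano2 (fun r => phit phi r x) t <= upper_peano2 (fun r => phibart phi r x) t)%E.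
Proof.
by move=> Gt; apply: touching_upper_peano2 (touching Gt) (Gint_phit Gt) (derive1_touching Gt).
Qed.

Lemma lower_peano2_le_upper (f : R -> R) t : (lower_peano2 f t <= upper_peano2 f t)%E.
Proof. exact: limf_einf_le_esup. Qed.

Let chain x t : Gint phi x t ->
  (lower_deriv (Dell_at phi x) (ellsq phi x) t
    <= lower_peano2 (fun r => phibart phi r x) t)%E /\
  (upper_peano2 (fun r => phit phi r x) t
    <= upper_deriv (Dellbar_at phi x) (ellbarsq phi x) t)%E.
Proof.
move=> Gt; split.
  exact: le_trans (lower_deriv_ellsq_le Gt) (lower_peano2_phit_le Gt).
exact: le_trans (upper_peano2_phit_le Gt) (upper_deriv_ellbarsq_ge Gt).
Qed.

Lemma lower_deriv_le_upper_deriv_bar x t : Gint phi x t ->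
  (lower_deriv (Dell_at phi x) (ellsq phi x) t
    <= upper_deriv (Dellbar_at phi x) (ellbarsq phi x) t)%E.
Proof.
move=> Gt; apply: le_trans (lower_deriv_ellsq_le Gt) _.
exact: le_trans (lower_peano2_le_upper _ _) (chain Gt).2.
Qed.

(** The chain encloses this derivative between reals, so the subtraction in (4) is one of real
    numbers. *)
Let lower_deriv_fin x t : Gint phi x t -> exists w, [/\
  lower_deriv (Dell_at phi x) (ellsq phi x) t = w%:E,
  - (2 * ellsq phi x t / t) <= w & w <= 2 * ellsq phi x t / (1 - t)].
Proof.
move=> Gt; have h1 := lower_deriv_ellsq_ge Gt.
have h2 := le_trans (lower_deriv_le_upper_deriv_bar Gt) (upper_deriv_ellbarsq_le Gt).
by case: lower_deriv h1 h2 => [w||]//; rewrite !lee_fin; exists w.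
Qed.

Let upper_deriv_bar_fin x t : Gint phi x t -> exists u, [/\
  upper_deriv (Dellbar_at phi x) (ellbarsq phi x) t = u%:E,
  - (2 * ellsq phi x t / t) <= u & u <= 2 * ellsq phi x t / (1 - t)].
Proof.
move=> Gt; have h1 := upper_deriv_ellbarsq_le Gt.
have h2 := le_trans (lower_deriv_ellsq_ge Gt) (lower_deriv_le_upper_deriv_bar Gt).
by case: upper_deriv h1 h2 => [w||]//; rewrite !lee_fin; exists w.
Qed.

Lemma upper_deriv_ellsq_le x t : Gint phi x t ->
  (upper_deriv (Dell_at phi x) (ellsq phi x) t
    <= upper_deriv (Dellbar_at phi x) (ellbarsq phi x) t
       + (2 * ellsq phi x t / (1 - t) + 2 * ellsq phi x t / t)%:E)%E.
Proof.
move=> Gt; have [u [uE _ u1]] := upper_deriv_bar_fin Gt; rewrite uE.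
have := (chain Gt).2; rewrite uE => h.
apply/lee_addgt0Pr => e e0.
have hc : (upper_peano2 (fun r => phit phi r x) t < (u + e / 2)%:E)%E.
  by apply: le_lt_trans h _; rewrite lte_fin; lra.
rewrite Dell_atE.
apply: le_trans (profile_upper_deriv_le_peano2 (profile_phit x) (Gint_S Gt) hc) _.
(* The factor 2 produces 2 u: one copy of u stays on the right, and [u1] bounds the other by 2 ellsq
   / (1 - t). *)
by rewrite -!EFinD lee_fin; lra.
Qed.

Lemma lower_deriv_ellbarsq_ge x t : Gint phi x t ->
  (lower_deriv (Dell_at phi x) (ellsq phi x) t
     - (2 * ellsq phi x t / t + 2 * ellsq phi x t / (1 - t))%:E
   <= lower_deriv (Dellbar_at phi x) (ellbarsq phi x) t)%E.
Proof.
move=> Gt; have [w [wE w0 _]] := lower_deriv_fin Gt; rewrite wE.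
have := (chain Gt).1; rewrite wE phibart_q (lower_peano2_1B (is_derive_q Gt)) => h.
rewrite Dellbar_atE (lower_deriv_1B (T x) (b' x)) leeNr; apply/lee_addgt0Pr => e e0.
have hc : (upper_peano2 (q x) (1 - t) < (- w + e / 2)%:E)%E.
  by rewrite leeNr -EFinN in h; apply: le_lt_trans h _; rewrite lte_fin; lra.
apply: le_trans (profile_upper_deriv_le_peano2 (profile_phibart x) (Gint_T Gt) hc) _.
rewrite -/(b' x (1 - t)) -ellbarsqE -(Gint_ellsq Gt) -EFinB -EFinN -EFinD lee_fin; lra.
Qed.

Let proper_S x t : Gint phi x t -> ProperFilter (within (Dell_at phi x) t^').
Proof. by move=> [t01 _]; rewrite Dell_atE; exact: (profile_within_proper (profile_phit x)). Qed.

Lemma lower_deriv_ellsq_le_upper x t : Gint phi x t ->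
  (lower_deriv (Dell_at phi x) (ellsq phi x) t
    <= upper_deriv (Dell_at phi x) (ellsq phi x) t)%E.
Proof. by move=> /proper_S ?; exact: limf_einf_le_esup. Qed.

Lemma lower_deriv_ellbarsq_le_upper x t : Gint phi x t ->
  (lower_deriv (Dellbar_at phi x) (ellbarsq phi x) t
    <= upper_deriv (Dellbar_at phi x) (ellbarsq phi x) t)%E.
Proof.
move=> Gt; have [s01 _] := Gint_T Gt; rewrite Dellbar_atE.
rewrite (upper_deriv_1B (T x) (b' x)) (lower_deriv_1B (T x) (b' x)) leeN2.
have := profile_within_proper (profile_phibart x) s01 => ?.
exact: limf_einf_le_esup.
Qed.

End kantorovich.

(** * Regularity of the speeds in time *)

Section time_regularity.
Context {R : realType} {X : metricType R}.
Variable phi : X -> R.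
Hypothesis phiK : Kantorovich_potential (EFin \o phi).
Implicit Types (x : X) (t s : R).
Notation mu := (@lebesgue_measure R).

Lemma continuous_ellsq x t : Dell_at phi x t -> ellsq phi x @ t --> ellsq phi x t.
Proof. by rewrite (Dell_atE phiK); exact: (profile_continuous_b (profile_phit phiK x)). Qed.

Lemma continuous_ellbarsq x t : Dellbar_at phi x t -> ellbarsq phi x @ t --> ellbarsq phi x t.
Proof.
rewrite (Dellbar_atE phiK) => Tt; rewrite ellbarsqE.
have c1 : (fun r : R => 1 - r) @ t --> 1 - t by apply: cvgB; [exact: cvg_cst|exact: cvg_id].
exact: (cvg_comp _ _ c1 (profile_continuous_b (profile_phibart phiK x) Tt)).
Qed.

Lemma ae_differentiable_ellsq x : {ae mu, forall t, Dell_at phi x t ->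
  differentiable_in (Dell_at phi x) (ellsq phi x) t}.
Proof.
apply: negligibleS (profile_ae_derivable (profile_phit phiK x)) => t.
apply: contra_not => H; rewrite (Dell_atE phiK) => -[t01 _]; have [_ db] := H t01.
apply: derivable_differentiable_in db.
exact: (profile_within_proper (profile_phit phiK x)).
Qed.

(** Lebesgue's theorem is applied in the original time to the nondecreasing function - (1 - t)^2
    ellbar^2 / 2, which avoids reflecting a null set. *)
Lemma ae_differentiable_ellbarsq x : {ae mu, forall t, Dellbar_at phi x t ->
  differentiable_in (Dellbar_at phi x) (ellbarsq phi x) t}.
Proof.
have P := profile_phibart phiK x.
pose h t := - ((1 - t) ^+ 2 * ellbarsq phi x t).
have hm r s : 0 < r -> r <= s -> s < 1 -> h r <= h s.
  move=> r0 rs s1; rewrite lerN2 !ellbarsqE.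
  by apply: (profile_BB P); [rewrite subr_gt0|rewrite lerD2l lerN2|rewrite gtrBl].
apply: negligibleS (nondecreasing_ae_derivable01 hm) => t.
apply: contra_not => H; rewrite (Dellbar_atE phiK) => -[s01 _].
have t01 : 0 < t < 1 by case/andP: s01 => ? ?; apply/andP; split; lra.
have /andP[t0 t1] := t01; have dh := H t01.
apply: derivable_differentiable_in.
  have FP := profile_within_proper P s01.
  apply: Build_ProperFilter => /(within_dnbhs1B _ t set0).
  exact: filter_not_empty.
have dV : derivable (fun s : R => ((1 - s) ^+ 2)^-1) t 1.
  apply: (@ex_derive _ _ _ _ _ _ _ _); apply: is_deriveV.
  by rewrite expf_neq0// subr_eq0 gt_eqF.
apply: near_eq_derivable (derivableN (derivableM dh dV)); near=> s.
have s1 : s < 1 by near: s; exact: lt_nbhsl.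
change (- (h s * ((1 - s) ^+ 2)^-1) = ellbarsq phi x s).
rewrite /h mulNr opprK mulrAC divff ?mul1r// expf_neq0// subr_eq0 gt_eqF//.
Unshelve. all: by end_near. Qed.

(** The factors 4 cover all four derivatives, whose largest bounds are (2 / (1 - t) + 1 / t) l^2 and
    its mirror image; continuity of [ellsq] makes this expression locally bounded. *)
Lemma Gint_locally_bounded x (h : R -> \bar R) :
  (forall t, Gint phi x t -> (`|h t| <= (4 * ellsq phi x t / (1 - t) + 4 * ellsq phi x t / t)%:E)%E) ->
  locally_bounded_on (Gint phi x) h.
Proof.
move=> H t Gt; have [/andP[t0 t1] _] := Gt.
have cL := continuous_ellsq (Gint_Dell phiK Gt).1.
pose L := ellsq phi x t + 1.
exists (4 * L / ((1 - t) / 2) + 4 * L / (t / 2)).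
have near_t : \forall s \near t, [/\ t / 2 < s, s < (1 + t) / 2 & ellsq phi x s < L].
  near=> s; split; near: s.
  - by apply: lt_nbhsr; lra.
  - by apply: lt_nbhsl; lra.
  - by apply: (cvgr_lt _ cL); rewrite /L ltrDl.
apply: filterS near_t => s [s1 s2 sL] Gs; apply: le_trans (H s Gs) _.
have L0 : 0 <= ellsq phi x s by rewrite divr_ge0// sqr_ge0.
rewrite lee_fin; move: (ellsq phi x s) L0 sL => l l0 lL.
have V1 : (1 - s)^-1 <= ((1 - t) / 2)^-1 by rewrite lef_pV2 ?posrE; lra.
have V2 : s^-1 <= (t / 2)^-1 by rewrite lef_pV2 ?posrE; lra.
by apply: lerD; apply: ler_pM => //; rewrite ?invr_ge0; lra.
Unshelve. all: by end_near. Qed.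

Lemma abse_le_fin (y : \bar R) (k : R) :
  ((- k)%:E <= y -> y <= k%:E -> `|y| <= k%:E)%E.
Proof. by case: y => [y||]//=; rewrite !lee_fin ler_norml => -> ->. Qed.

(** As t (1 - s) + s (1 - t) = t (1 - t) + s (1 - s) + (t - s)^2, the cyclic inequality becomes m
    D^2 <= M^2 k^2 + D k M with D = |l - l'| and k = |t - s|, which bounds D linearly in k. *)
Lemma Gint_lipschitz x t s (M m : R) : Gint phi x t -> Gint phi x s ->
  ell phi t x <= M -> ell phi s x <= M -> 0 < m -> m <= 1 -> m <= t * (1 - t) ->
  `|ell phi t x - ell phi s x| <= 2 * (M + 1) / m * `|t - s|.
Proof.
move=> Gt Gs tM sM m0 m1 mt.
have := Gint_cyclic phiK Gt Gs; have := Gint_ell_ge0 phiK Gt; have := Gint_ell_ge0 phiK Gs.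
move: (ell phi t x) (ell phi s x) tM sM => l l' lM l'M l'0 l0 H.
set k := `|t - s|; have k0 : 0 <= k by exact: normr_ge0.
set D := `|l - l'|; have D0 : 0 <= D by exact: normr_ge0.
have k2 : (t - s) ^+ 2 = k ^+ 2 by rewrite real_normK ?num_real.
have D2 : (l - l') ^+ 2 = D ^+ 2 by rewrite real_normK ?num_real.
have [/andP[t0 t1] _] := Gt; have [/andP[s0 s1] _] := Gs.
have ts : `|t * (1 - t) - s * (1 - s)| <= k.
  have -> : t * (1 - t) - s * (1 - s) = (t - s) * (1 - t - s) by ring.
  by rewrite normrM ler_piMr// ler_norml; apply/andP; split; lra.
have H1 : t * (1 - t) * D ^+ 2 <= l * l' * k ^+ 2 + D * k * l'.
  have : - ((l - l') * (t * (1 - t) - s * (1 - s))) * l' <= D * k * l'.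
    rewrite ler_wpM2r//; apply: le_trans (ler_norm _) _.
    by rewrite normrN normrM ler_wpM2l.
  rewrite -k2 -D2; move: H; rewrite !expr2; lra.
have M0 : 0 <= M by lra.
have H2 : m * D ^+ 2 <= M ^+ 2 * k ^+ 2 + D * k * M.
  have h1 : m * D ^+ 2 <= t * (1 - t) * D ^+ 2 by rewrite ler_wpM2r// sqr_ge0.
  have h2 : l * l' * k ^+ 2 <= M ^+ 2 * k ^+ 2.
    by rewrite ler_wpM2r ?sqr_ge0// expr2 ler_pM.
  have h3 : D * k * l' <= D * k * M by rewrite ler_wpM2l// mulr_ge0.
  lra.
(* If D m exceeded w, the two terms on the right of [H2] would be at most 1 / 4 (here m <= 1 enters)
   and 1 / 2 of m D^2. *)
rewrite mulrAC ler_pdivlMr// leNgt; apply/negP => lt.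
pose w := 2 * (M + 1) * k; rewrite -/w in lt.
have Mk : M * k <= w / 2 by rewrite /w; lra.
have Mk0 : 0 <= M * k by rewrite mulr_ge0.
have w0 : 0 <= w by rewrite !mulr_ge0//; lra.
have Dp : 0 < D by rewrite -(pmulr_lgt0 _ m0); exact: le_lt_trans lt.
have h1 : (M * k) ^+ 2 <= (w / 2) ^+ 2 by rewrite ler_sqr ?nnegrE//; lra.
have h2 : D * (M * k) <= D * (w / 2) by rewrite ler_wpM2l.
have h3 : (w / 2) ^+ 2 <= (D * m / 2) ^+ 2 by rewrite ler_sqr ?nnegrE//; lra.
have h4 : D * (w / 2) <= D * (D * m / 2) by rewrite ler_wpM2l//; lra.
have h5 : m * (m * D ^+ 2) <= m * D ^+ 2 by rewrite ger_pMl// mulr_gt0// exprn_gt0.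
have h6 : 0 < m * D ^+ 2 by rewrite mulr_gt0// exprn_gt0.
by rewrite !expr2 in H2 h1 h2 h3 h4 h5 h6; lra.
Qed.

(** Locality concerns pairs (t, s), off the diagonal as well, so bounds found near two separate
    times are combined. *)
Lemma Gint_locally_lipschitz x :
  [locally [lipschitz (ell phi t x : R^o) | t in (Gint phi x : set R^o)]].
Proof.
move=> [t s] [/= Gt Gs].
have near_bound (r : R) : Gint phi x r -> exists Mr mr : R, [/\ 0 < mr, mr <= 1 &
    \forall u \near r, ell phi u x <= Mr /\ mr <= u * (1 - u)].
  move=> Gr; have [/andP[r0 r1] _] := Gr.
  have rr : 0 < r * (1 - r) by rewrite mulr_gt0// subr_gt0.
  have rr1 : r * (1 - r) <= 1 by rewrite mulr_ile1//; lra.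
  exists (ellsq phi x r + 2), (r * (1 - r) / 2); split; [lra|lra|].
  have cL := continuous_ellsq (Gint_Dell phiK Gr).1.
  have cu : (fun u : R => u * (1 - u)) @ r --> r * (1 - r).
    by apply: cvgM; [exact: cvg_id|apply: cvgB; [exact: cvg_cst|exact: cvg_id]].
  near=> u.
  have h1 : ellsq phi x u < ellsq phi x r + 1 by near: u; apply: (cvgr_lt _ cL); rewrite ltrDl.
  have h2 : r * (1 - r) / 2 < u * (1 - u) by near: u; apply: (cvgr_gt _ cu); lra.
  split; last exact: ltW.
  (* l <= (l^2 + 1) / 2 bounds the speed by its halved square. *)
  by move: h1; rewrite {1}/ellsq; have := sqr_ge0 (ell phi u x - 1); rewrite !expr2; lra.
have [M1 [m1 [m10 m11 H1]]] := near_bound t Gt.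
have [M2 [m2 [m20 m21 H2]]] := near_bound s Gs.
pose M := Num.max M1 M2.
exists (2 * (M + 1) / m1); split; first exact: num_real.
move=> K /ltW KM; exists ([set u | ell phi u x <= M1 /\ m1 <= u * (1 - u)],
                 [set u | ell phi u x <= M2 /\ m2 <= u * (1 - u)]) => //.
move=> [u v] [/= [u1 u2] [v1 v2]] [/= Gu Gv].
have uM : ell phi u x <= M by rewrite le_max u1.
have vM : ell phi v x <= M by rewrite le_max v1 orbT.
change (`|ell phi u x - ell phi v x| <= K * `|u - v|).
apply: le_trans (Gint_lipschitz Gu Gv uM vM m10 m11 u2) _.
by rewrite ler_wpM2r.
Unshelve. all: by end_near. Qed.

(** After squaring, the cross terms cancel because both products of roots equal the root of t (1 -
    t) s (1 - s); [Gint_cyclic] remains. *)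
Lemma Gint_sqrt x t s : Gint phi x t -> Gint phi x s ->
  `|Num.sqrt (t * (1 - t)) * ell phi t x - Num.sqrt (s * (1 - s)) * ell phi s x| <=
  Num.sqrt (ell phi t x * ell phi s x) * `|Num.sqrt (t * (1 - s)) - Num.sqrt (s * (1 - t))|.
Proof.
move=> Gt Gs; have := Gint_cyclic phiK Gt Gs.
have := Gint_ell_ge0 phiK Gt; have := Gint_ell_ge0 phiK Gs.
move: (ell phi t x) (ell phi s x) => l l' l'0 l0.
have [/andP[t0 t1] _] := Gt; have [/andP[s0 s1] _] := Gs.
have sq (a b : R) : 0 < a -> b < 1 -> Num.sqrt (a * (1 - b)) ^+ 2 = a * (1 - b).
  by move=> a0 b1; rewrite sqr_sqrtr// mulr_ge0//; lra.
have E : Num.sqrt (t * (1 - t)) * Num.sqrt (s * (1 - s)) =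
    Num.sqrt (t * (1 - s)) * Num.sqrt (s * (1 - t)).
  by rewrite -!sqrtrM ?mulr_ge0 ?subr_ge0 ?ltW//; congr Num.sqrt; ring.
have := sq _ _ t0 t1; have := sq _ _ s0 s1; have := sq _ _ t0 s1; have := sq _ _ s0 t1.
move: E; set a := Num.sqrt (t * (1 - t)); set b := Num.sqrt (s * (1 - s)).
set c := Num.sqrt (t * (1 - s)); set d := Num.sqrt (s * (1 - t)) => E d2 c2 b2 a2 H.
rewrite -sqrtr_sqr -[`|c - d|]sqrtr_sqr -sqrtrM ?mulr_ge0// ler_wsqrtr//.
have -> : (a * l - b * l') ^+ 2 = a ^+ 2 * l ^+ 2 + b ^+ 2 * l' ^+ 2 - 2 * (a * b) * l * l' by ring.
have -> : l * l' * (c - d) ^+ 2 = l * l' * (c ^+ 2 + d ^+ 2) - 2 * (c * d) * l * l' by ring.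
by rewrite E a2 b2 c2 d2 lerD2r.
Qed.

End time_regularity.

Theorem theorem3p11 (R : realType) (X : metricType R)
    (Xproper : proper_space X) (Xgeod : geodesic_space X)
    (phi : X -> R) (phiK : Kantorovich_potential (EFin \o phi)) :
  (* (1) *)
  ((forall (t : R) (x : X), 0 < t < 1 -> (ev t @` Gphi phi) x ->
      forall g, Gphi phi g -> g t = x ->
      [/\ ellp phi t x = (len g)%:E, ellm phi t x = (len g)%:E,
          ellbarp phi t x = (len g)%:E & ellbarm phi t x = (len g)%:E]) /\
   [/\ DG phi = [set p | 0 < p.2 < 1 /\ exists2 g, Gphi phi g & p.1 = g p.2],
       DG phi `<=` Dell phi `&` Dellbar phi &
       forall (x : X) (t : R), DG phi (x, t) ->
         ell phi t x = ellbar phi t x]) /\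
  (* (2) *)
  (forall x : X,
     [locally [lipschitz (ell phi t x : R^o) | t in (Gint phi x : set R^o)]] /\
     (forall t s : R, Gint phi x t -> Gint phi x s ->
        `|Num.sqrt (t * (1 - t)) * ell phi t x -
          Num.sqrt (s * (1 - s)) * ell phi s x| <=
        Num.sqrt (ell phi t x * ell phi s x) *
        `|Num.sqrt (t * (1 - s)) - Num.sqrt (s * (1 - t))|)) /\
  (* (3) *)
  (forall (x : X) (t : R), DG phi (x, t) ->
     let phix := fun r : R => phit phi r x in
     let phibarx := fun r : R => phibart phi r x in
     forall star : \bar R,
       star = lower_peano2 phibarx t \/ star = upper_peano2 phix t ->
     ((- (t^-1 * ell phi t x ^+ 2))%:E
        <= lower_deriv (Dell_at phi x) (ellsq phi x) t)%E /\
     (lower_deriv (Dell_at phi x) (ellsq phi x) t <= lower_peano2 phix t)%E /\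
     (lower_peano2 phix t <= star)%E /\
     (star <= upper_peano2 phibarx t)%E /\
     (upper_peano2 phibarx t
        <= upper_deriv (Dellbar_at phi x) (ellbarsq phi x) t)%E /\
     (upper_deriv (Dellbar_at phi x) (ellbarsq phi x) t
        <= ((1 - t)^-1 * ell phi t x ^+ 2)%:E)%E) /\
  (* (4) *)
  (forall (x : X) (t : R), DG phi (x, t) ->
     [/\ (upper_deriv (Dell_at phi x) (ellsq phi x) t
            <= upper_deriv (Dellbar_at phi x) (ellbarsq phi x) t
               + (((1 - t)^-1 + t^-1) * ell phi t x ^+ 2)%:E)%E,
         (upper_deriv (Dellbar_at phi x) (ellbarsq phi x) t
            + (((1 - t)^-1 + t^-1) * ell phi t x ^+ 2)%:E
            <= ((2 / (1 - t) + t^-1) * ell phi t x ^+ 2)%:E)%E,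
         (lower_deriv (Dell_at phi x) (ellsq phi x) t
            - ((t^-1 + (1 - t)^-1) * ell phi t x ^+ 2)%:E
            <= lower_deriv (Dellbar_at phi x) (ellbarsq phi x) t)%E &
         ((- ((2 / t + (1 - t)^-1) * ell phi t x ^+ 2))%:E
            <= lower_deriv (Dell_at phi x) (ellsq phi x) t
               - ((t^-1 + (1 - t)^-1) * ell phi t x ^+ 2)%:E)%E]) /\
  (* in particular *)
  (forall x : X,
     (forall t : R, Gint phi x t ->
        [/\ is_derive t 1 (fun r : R => phit phi r x : R^o) (ellsq phi x t),
            is_derive t 1 (fun r : R => phibart phi r x : R^o)
              (ellsq phi x t) &
            ellsq phi x t = ellbarsq phi x t]) /\
     [/\ {within Dell_at phi x `&` Dellbar_at phi x, continuous (ellsq phi x)} /\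
         {within Dell_at phi x `&` Dellbar_at phi x,
           continuous (ellbarsq phi x)},
         {ae (@lebesgue_measure R), forall t,
            (Dell_at phi x `&` Dellbar_at phi x) t ->
            differentiable_in (Dell_at phi x) (ellsq phi x) t /\
            differentiable_in (Dellbar_at phi x) (ellbarsq phi x) t},
         Gint phi x `<=` Dell_at phi x `&` Dellbar_at phi x,
         locally_bounded_on (Gint phi x)
           (lower_deriv (Dell_at phi x) (ellsq phi x)) /\
         locally_bounded_on (Gint phi x)
           (upper_deriv (Dell_at phi x) (ellsq phi x)) &
         locally_bounded_on (Gint phi x)
           (lower_deriv (Dellbar_at phi x) (ellbarsq phi x)) /\
         locally_bounded_on (Gint phi x)
           (upper_deriv (Dellbar_at phi x) (ellbarsq phi x))]).

Proof.
split; first split.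
- by move=> t x t01 _ g Gg <-; exact: (Gphi_speeds phiK).
- split.
  + apply/seteqP; split=> -[x t] /= [t01].
      by move=> [_ [g Gg gx]]; split=> //; exists g.
    by move=> [g Gg gx]; split=> //; split=> //; exists g.
  + by move=> [x t] [_ /(Gint_Dell phiK)].
  + by move=> x t [_ /(Gint_ellbar phiK)].
split; first by move=> x; split; [exact: Gint_locally_lipschitz|exact: Gint_sqrt].
have ellE x t c : c * ell phi t x ^+ 2 = 2 * ellsq phi x t * c.
  by rewrite /ellsq; field.
split.
  move=> x t [_ Gt] phix phibarx star Hs; rewrite !ellE.
  have Hchain : (lower_peano2 phix t <= star)%E /\ (star <= upper_peano2 phibarx t)%E.
    case: Hs => ->; split.
    - exact: lower_peano2_phit_le.
    - exact: lower_peano2_le_upper.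
    - exact: lower_peano2_le_upper.
    - exact: upper_peano2_phit_le.
  split; first exact: lower_deriv_ellsq_ge.
  split; first exact: lower_deriv_ellsq_le.
  split; first exact: Hchain.1.
  split; first exact: Hchain.2.
  split; first exact: upper_deriv_ellbarsq_ge.
  exact: upper_deriv_ellbarsq_le.
split.
  move=> x t [_ Gt]; rewrite !ellE.
  have h1 := lower_deriv_ellsq_ge phiK Gt; have h2 := upper_deriv_ellbarsq_le phiK Gt.
  split.
  - by rewrite mulrDr; exact: upper_deriv_ellsq_le.
  - apply: le_trans (leeD2r _ h2) _; rewrite -EFinD lee_fin; lra.
  - by rewrite mulrDr; exact: lower_deriv_ellbarsq_ge.
  - apply: le_trans (leeD2r _ h1); rewrite -EFinD lee_fin; lra.
move=> x; split.
  move=> t Gt; split.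
  - exact: is_derive_phit.
  - exact: is_derive_phibart.
  - exact: Gint_ellsq.
have bounds t : Gint phi x t -> let k := 4 * ellsq phi x t / (1 - t) + 4 * ellsq phi x t / t in
    [/\ ((- k)%:E <= lower_deriv (Dell_at phi x) (ellsq phi x) t)%E,
        (upper_deriv (Dell_at phi x) (ellsq phi x) t <= k%:E)%E,
        ((- k)%:E <= lower_deriv (Dellbar_at phi x) (ellbarsq phi x) t)%E &
        (upper_deriv (Dellbar_at phi x) (ellbarsq phi x) t <= k%:E)%E].
  move=> Gt k; have [/andP[t0 t1] _] := Gt.
  have L0 : 0 <= ellsq phi x t by rewrite divr_ge0// sqr_ge0.
  have u0 : 0 <= ellsq phi x t / (1 - t) by rewrite divr_ge0//; lra.
  have v0 : 0 <= ellsq phi x t / t by rewrite divr_ge0//; lra.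
  have h1 := lower_deriv_ellsq_ge phiK Gt; have h2 := upper_deriv_ellbarsq_le phiK Gt.
  split.
  - by apply: le_trans h1; rewrite lee_fin /k; lra.
  - apply: le_trans (upper_deriv_ellsq_le phiK Gt) _.
    by apply: le_trans (leeD2r _ h2) _; rewrite -EFinD lee_fin /k; lra.
  - apply: le_trans (lower_deriv_ellbarsq_ge phiK Gt).
    by apply: le_trans (leeD2r _ h1); rewrite -EFinD lee_fin /k; lra.
  - by apply: le_trans h2 _; rewrite lee_fin /k; lra.
split.
- split; apply: continuous_in_subspaceT => t; rewrite inE => -[S T].
    exact: continuous_ellsq.
  exact: continuous_ellbarsq.
- apply: negligibleS (negligibleU (ae_differentiable_ellsq phiK x)
    (ae_differentiable_ellbarsq phiK x)) => t /not_implyP[[S T]] /not_andP[h|h].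
    by left; apply: contra_not h; exact.
  by right; apply: contra_not h; exact.
- by move=> t /(Gint_Dell phiK).
- split; apply: (Gint_locally_bounded phiK) => t Gt; have [b1 b2 b3 b4] := bounds t Gt.
    exact: abse_le_fin b1 (le_trans (lower_deriv_ellsq_le_upper phiK Gt) b2).
  exact: abse_le_fin (le_trans b1 (lower_deriv_ellsq_le_upper phiK Gt)) b2.
- split; apply: (Gint_locally_bounded phiK) => t Gt; have [b1 b2 b3 b4] := bounds t Gt.
    exact: abse_le_fin b3 (le_trans (lower_deriv_ellbarsq_le_upper phiK Gt) b4).
  exact: abse_le_fin (le_trans b3 (lower_deriv_ellbarsq_le_upper phiK Gt)) b4.
Qed.
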